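(* Let $M>0$ and $u\in C_M$. Suppose that $u$ contains a conical part with vertex $(x_0,y_0,-z_0)$ and arc $\{(\cos\varphi,\sin\varphi,0):\varphi\in[\alpha,\beta]\}$, where $z_0>0$, $(x_0,y_0)=(r_0\cos\varphi_0,r_0\sin\varphi_0)$ with $0<r_0<1$, and $\alpha<\beta$. If there exists $\varphi\in[\alpha,\beta]$ such that \[ \frac{3r_0^2\sin^2(\varphi-\varphi_0)-[1-r_0\cos(\varphi-\varphi_0)]^2}{[1-r_0\cos(\varphi-\varphi_0)]^2\,[1+r_0^2-2r_0\cos(\varphi-\varphi_0)]}<z_0^{-2}, \] then $u$ is not optimal for $J$, i.e. $u$ is not a minimizer of $J$ over $C_M$.
   Context: Let $\Omega=\{(x,y)\in\mathbb{R}^2: x^2+y^2\le 1\}$. For $M>0$, $C_M$ denotes the set of all functions $u\colon\Omega\to[-M,0]$ that are convex and closed (i.e. lower semicontinuous). Each such $u$ is locally Lipschitz in $\operatorname{int}\Omega$, hence differentiable a.e., and \[ J(u)=\int_\Omega\frac{1}{|\nabla u|^2+1}\,dx\,dy . \] Saying that $u$ contains a conical part with vertex $(x_0,y_0,-z_0)$ and arc $\{(\cos\varphi,\sin\varphi,0):\varphi\in[\alpha,\beta]\}\subset\partial\Omega\times\{0\}$ means that the conical surface formed by all segments joining the vertex to points of the arc lies in the graph of $u$: for all $\lambda\in[0,1]$ and $\varphi\in[\alpha,\beta]$, \[ u\bigl((1-\lambda)x_0+\lambda\cos\varphi,\;(1-\lambda)y_0+\lambda\sin\varphi\bigr)=-(1-\lambda)z_0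 . \] *)

(* Defs.v *)
From HB Require Import structures.
From mathcomp Require Import all_boot all_order all_algebra.
From mathcomp Require Import all_classical all_reals all_analysis.

Set Implicit Arguments.
Unset Strict Implicit.
Unset Printing Implicit Defensive.

Import Order.TTheory GRing.Theory Num.Theory.
Import numFieldNormedType.Exports.

Local Open Scope classical_set_scope.
Local Open Scope ring_scope.

Definition unit_disc (R : realType) : set (R * R) :=
  [set p | p.1 ^+ 2 + p.2 ^+ 2 <= 1].

(* Functions on the disc are represented by total functions on the plane;
   their values off the disc are unconstrained.  Lower semicontinuity is
   relative to the disc, through the subspace topology. *)
Definition newton_class (R : realType) (M : R) (u : R * R -> R) : Prop :=
  [/\ forall p, unit_disc p -> - M <= u p <= 0,
      convex_function (@unit_disc R) u
    & lower_semicontinuous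
        ((fun p => (u p)%:E) : subspace (@unit_disc R) -> \bar R)].

(* The Euclidean |grad u|^2, through the partial derivatives; the norm of the
   library on R * R is the sup norm. *)
Definition sqr_grad (R : realType) (u : R * R -> R) (p : R * R) : R :=
  ('D_((1, 0) : R * R) u p) ^+ 2 + ('D_((0, 1) : R * R) u p) ^+ 2.

(* The integrand is meaningful at almost every point of the disc: where u is not
   differentiable, and on the bounding circle, where the partial derivatives
   see the values of u off the disc, it takes irrelevant values in [0, 1]. *)
Definition newton_resistance (R : realType) (u : R * R -> R) : \bar R :=
  (\int[(@lebesgue_measure R \x @lebesgue_measure R)%E]_(p in @unit_disc R)
     ((sqr_grad u p + 1)^-1)%:E)%E.

Definition newton_minimizer (R : realType) (M : R) (u : R * R -> R) : Prop :=
  newton_class M u /\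
  forall v, newton_class M v ->
    (newton_resistance u <= newton_resistance v)%E.

Definition conical_part (R : realType) (u : R * R -> R)
    (x0 y0 z0 alpha beta : R) : Prop :=
  forall lambda phi : R, 0 <= lambda <= 1 -> alpha <= phi <= beta ->
    u ((1 - lambda) * x0 + lambda * cos phi,
       (1 - lambda) * y0 + lambda * sin phi) = - ((1 - lambda) * z0).

(* Main.v *)
Require Import Defs.
From HB Require Import structures.
From mathcomp Require Import all_boot all_order all_algebra.
From mathcomp Require Import all_classical all_reals all_analysis.
From mathcomp Require Import measurable_realfun ring lra.
Set Implicit Arguments.
Unset Strict Implicit.
Unset Printing Implicit Defensive.
Import Order.TTheory GRing.Theory Num.Theory.
Import numFieldNormedType.Exports.
Local Open Scope classical_set_scope.
Local Open Scope ring_scope.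

(** Write [f(p) = 1 / (1 + |p|^2)], [V = (x0, y0)], [n(phi) = (cos phi, sin phi)].
On the segment from the vertex to [n(phi)] the gradient of [u] is the constant
vector [p(phi) = g(phi) n(phi)] with [g(phi) = z0 / (1 - <V, n(phi)>)], and when
[phi] varies [p(phi)] moves orthogonally to that segment.  The inequality of the
theorem says that [f] is strictly concave at [p(phi)] in this direction.  Being
strict, it holds at an angle [f0] interior to the arc.  Concavity suggests to
replace the gradients [p(phi)], for [phi] in a small arc [[a, b]] around [f0], by
more extreme ones.

The competitor [lowered] equals [u] outside the sector [S] that joins [V] to the
arc [[a, b]], and on [S] it is the maximum of the two planes tangent to the cone
along the edges of [S] and of [kap * u], with [kap] slightly larger than 1.  The
two planes alone would leave the value 0 on the arc, and the cost of this is of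
the same order as the gain; the steeper cone [kap * u], which vanishes on the
arc, forces [lowered = u] on the whole boundary of [S].  Each value of [lowered]
on [S] is taken by an affine function that lies below [lowered] on the disc, and
such a function touches [u] at the boundary points of [S] ([contact]); this gives
convexity and lower semicontinuity, hence a member of the class.

To compare the resistances, note that [u - lowered], extended by 0, is Lipschitz
with compact support, so that for every constant vector [d] the integral over [S]
of [<d, grad u - grad lowered>] is 0 ([integral_directional_derivative0]).  It is
therefore enough to find [d] and a level [al0] with [f(p) + <d, p> > al0] at the
gradients [p(phi)] of [u], and [f(p) + <d, p> <= al0] at the gradients [p(a)],
[p(b)], [kap p(phi)] of [lowered] ([lowered_resistance]).

These are provided by [tilt_exists].  With [d = - grad f(p(f0))] the function
[phi |-> f(p(phi)) + <d, p(phi)>] is stationary at [f0], and by concavity it has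
a strict local maximum there.  Subtracting from [d] a small multiple of the
direction of the ray through [f0] changes this function only by a constant and a
second order term, because [p] moves orthogonally to the ray, but strictly
lowers the values at [kap p(phi)].  The level [al0] is then chosen just below the
maximum, and [a], [b] are the nearest angles where it is reached.

Two points of measure theory remain.  The gradient of [lowered] exists away from
the kinks, which lie on zero sets of nonzero polynomials of degree at most two
([kinks_null]).  Outside [S] the integrand need not be measurable; there the two
integrands coincide, and [lower_integral_lt] shows that the comparison on [S] is
enough. *)

(** * Lower integrals *)

Section lower.
Local Open Scope ereal_scope.
Context d (T : measurableType d) (R : realType) (mu : {measure set T -> \bar R}).
Import HBNNSimple.

(** The integral of a nonnegative function, measurable or not, is a supremum over
the simple functions below it. *)
Lemma ge0_le_lower_integral (k f : T -> \bar R) :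
  (forall x, 0 <= k x) -> (forall x, k x <= f x) ->
  \int[mu]_x k x <= \int[mu]_x f x.
Proof.
move=> k0 kf; have f0 x : 0 <= f x by exact: le_trans (k0 x) (kf x).
rewrite !ge0_integralTE//; apply: ge_ereal_sup => _ [h /= hk <-].
by apply: ereal_sup_ubound; exists h => // x; exact: le_trans (hk x) (kf x).
Qed.

(** A simple function below [g] is, up to the null set, the sum of its parts on
[C] and on [Z].  On [C] it is also below [f], and on [Z] its integral is at most
that of [g]; replacing this second part by [f] gives a minorant of [f]. *)
Lemma lower_integral_lt (D C Z : set T) (f g : T -> \bar R) :
  measurable D -> measurable C -> measurable Z ->
  C `|` Z `<=` D -> C `&` Z = set0 -> mu (D `\` (C `|` Z)) = 0 ->
  (forall x, 0 <= f x) -> (forall x, 0 <= g x) ->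
  (forall x, C x -> f x = g x) ->
  measurable_fun Z f -> measurable_fun Z g ->
  \int[mu]_(x in Z) g x < \int[mu]_(x in Z) f x ->
  \int[mu]_(x in D) f x < +oo ->
  \int[mu]_(x in D) g x < \int[mu]_(x in D) f x.
Proof.
move=> mD mC mZ CZD CZ0 N0 f0 g0 fg mf mg gf fD.
have aD : \int[mu]_(x in Z) f x <= \int[mu]_(x in D) f x.
  rewrite [leLHS]integral_mkcond [leRHS]integral_mkcond; apply: ge0_le_lower_integral.
    by move=> x; rewrite patchE; case: ifP.
  move=> x; rewrite !patchE; case: ifPn => [xZ|_]; last by case: ifP.
  by rewrite mem_set//; apply: CZD; right; exact: set_mem.
suff H : \int[mu]_(x in D) g x + \int[mu]_(x in Z) f x <=
    \int[mu]_(x in D) f x + \int[mu]_(x in Z) g x.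
  have g0Z : 0 <= \int[mu]_(x in Z) g x by exact: integral_ge0.
  have g0D : 0 <= \int[mu]_(x in D) g x by exact: integral_ge0.
  move: g0Z g0D gf fD aD H.
  case: (\int[mu]_(x in D) g x) => [gD||]; case: (\int[mu]_(x in D) f x) => [fD||];
  case: (\int[mu]_(x in Z) g x) => [gZ||]; case: (\int[mu]_(x in Z) f x) => [fZ||] //=.
  by rewrite -!EFinD !lee_fin !lte_fin => *; lra.
have fZfin : \int[mu]_(x in Z) f x \is a fin_num.
  by rewrite ge0_fin_numE ?(le_lt_trans aD)//; exact: integral_ge0.
rewrite -leeBrDr//.
rewrite [X in X <= _](integral_mkcond D) ge0_integralTE; last first.
  by move=> x; rewrite patchE; case: ifP.
apply: ge_ereal_sup => _ [h /= hg <-]; rewrite leeBrDr// -integralT_nnsfun.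
have h0 x : 0 <= (h x)%:E by rewrite lee_fin.
have hp A x : 0 <= ((EFin \o h) \_ A) x.
  by rewrite patchE; case: ifP => _ //; exact: h0.
have mh : measurable_fun setT (EFin \o h) by exact/measurable_EFinP.
have mhp A : measurable A -> measurable_fun setT ((EFin \o h) \_ A).
  by move=> mA; apply/(measurable_restrictT _ _).1 => //; exact: measurable_funTS.
have mfp : measurable_fun setT (f \_ Z) by exact/(measurable_restrictT _ _).1.
have fp x : 0 <= (f \_ Z) x by rewrite patchE; case: ifP.
have CZ x : x \in C -> x \in Z -> False.
  by rewrite !inE => Cx Zx; have : (C `&` Z) x by []; rewrite CZ0.
have -> : \int[mu]_x (h x)%:E = \int[mu]_(x in C) (h x)%:E + \int[mu]_(x in Z) (h x)%:E.
  rewrite [X in _ = X + _]integral_mkcond [X in _ = _ + X]integral_mkcond.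
  rewrite -ge0_integralD//; [|exact: mhp|exact: mhp].
  apply: ge0_ae_eq_integral => //; [|by move=> x _; exact: adde_ge0|].
    by apply: emeasurable_funD; exact: mhp.
  exists (D `\` (C `|` Z)); split => //; first by apply: measurableD => //;
      exact: measurableU.
  move=> x /= H; split.
    apply: contrapT => nDx; apply: H => _; have := hg x.
    rewrite !patchE (memNset nDx) memNset => [|Cx]; last by apply/nDx/CZD; left.
    rewrite memNset => [|Zx]; last by apply/nDx/CZD; right.
    by rewrite adde0 => hx; apply/eqP; rewrite eq_le hx h0.
  move=> CZx; apply: H => _; rewrite !patchE.
  case: ifPn => xC; case: ifPn => xZ; rewrite ?adde0 ?add0e//.
    by have := CZ _ xC xZ.
  by case: CZx; [move/mem_set; rewrite (negbTE xC)|move/mem_set; rewrite (negbTE xZ)].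
rewrite -addeA (addeC (\int[mu]_(x in Z) (h x)%:E)) addeA; apply: leeD.
  rewrite [X in X + _]integral_mkcond [X in _ + X]integral_mkcond
      [leRHS]integral_mkcond.
  rewrite -ge0_integralD//; last exact: mhp.
  apply: ge0_le_lower_integral => [x|x]; first exact: adde_ge0.
  rewrite !patchE; case: ifPn => [xC|xC].
    rewrite ifF; last by apply/negP => xZ; exact: CZ xC xZ.
    have xD : x \in D by rewrite inE; apply: CZD; left; exact: set_mem.
    have := hg x; rewrite patchE xD adde0 -fg//; exact: set_mem.
  rewrite add0e; case: ifPn => [xZ|xZ]; last by case: ifP.
  by rewrite mem_set//; apply: CZD; right; exact: set_mem.
apply: ge0_le_integral => //; first exact: measurable_funTS.
move=> x Zx; have := hg x; rewrite patchE mem_set//; apply: CZD; by right.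
Qed.
End lower.

Section strict.
Context d (T : measurableType d) (R : realType) (mu : {measure set T -> \bar R}).

(** The compensating term [k] has integral 0, so it may be added to [f] before
the pointwise comparison. *)
Lemma integral_lt_compensated (Z : set T) (f g k : T -> R) :
  measurable Z -> (0 < mu Z)%E -> (mu Z < +oo)%E ->
  measurable_fun Z f -> measurable_fun Z g ->
  (forall x, Z x -> 0 <= f x <= 1) -> (forall x, Z x -> 0 <= g x <= 1) ->
  mu.-integrable Z (EFin \o k) -> (\int[mu]_(x in Z) (k x)%:E = 0)%E ->
  (forall x, Z x -> g x < f x + k x) ->
  (\int[mu]_(x in Z) (g x)%:E < \int[mu]_(x in Z) (f x)%:E)%E.
Proof.
move=> mZ Z0 Zoo mf mg f01 g01 ik k0 gfk.
have ib (h : T -> R) : measurable_fun Z h -> (forall x, Z x -> 0 <= h x <= 1) ->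
    mu.-integrable Z (EFin \o h).
  move=> mh h01; apply: (@le_integrable _ _ _ _ _ _ _ (cst 1%E)) => //.
  - exact/measurable_EFinP.
  - by move=> x /h01/andP[h0 h1]; rewrite /= lee_fin !ger0_norm.
  - by apply/integrableP; split => //; rewrite integral_cst//= normr1 mul1e.
have If := ib _ mf f01; have Ig := ib _ mg g01.
pose w x := ((f x)%:E + (k x)%:E - (g x)%:E)%E.
have iw : mu.-integrable Z w := integrableB mZ (integrableD mZ If ik) Ig.
have wE : (\int[mu]_(x in Z) w x =
        \int[mu]_(x in Z) (f x)%:E - \int[mu]_(x in Z) (g x)%:E)%E.
  transitivity (\int[mu]_(x in Z) ((f x)%:E + (k x)%:E) - \int[mu]_(x in Z) (g x)%:E)%E.
    exact: (integralB mZ (integrableD mZ If ik) Ig).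
  by rewrite integralD// k0 adde0.
have w0 x : Z x -> (0 < w x)%E.
  by move=> /gfk h; rewrite /w sube_gt0 lte_fin.
have : (0 < \int[mu]_(x in Z) w x)%E.
  rewrite lt_neqAle integral_ge0 ?andbT; last by move=> x /w0/ltW.
  apply/negP => /eqP/esym h.
  have /(ae_eq_integral_abs mu mZ (measurable_int _ iw)).1 : (\int[mu]_(x in Z) `|w x| =
      0)%E.
    by rewrite -[RHS]h; apply: eq_integral => x /set_mem/w0/ltW ?; rewrite gee0_abs.
  move=> [N [mN N0 ZN]].
  have : (mu Z <= mu N)%E.
    apply: le_measure; rewrite ?inE// => x Zx; apply: ZN => /= /(_ Zx) wx.
    by have := w0 _ Zx; rewrite wx ltxx.
  by rewrite N0 leNgt Z0.
rewrite wE sube_gt0//.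
Qed.
End strict.

(** * Lebesgue measure on the plane *)

(** The Borel structure that carries the Lebesgue measure is attached to
[measurableTypeR R], not to the canonical one on [R]. *)
Notation plane R := (measurableTypeR R * measurableTypeR R)%type.

Definition leb2 (R : realType) := (@lebesgue_measure R \x @lebesgue_measure R)%E.

Arguments leb2 R : clear implicits.

HB.instance Definition _ (R : realType) := Measure.on (@leb2 R).

Section shift.
Context (R : realType).

Definition shift1 (a : R) : measurableTypeR R -> measurableTypeR R := fun x => x + a.
Definition shift2 (d : R * R) : plane R -> plane R :=
  fun p => (p.1 + d.1, p.2 + d.2).

Lemma measurable_shift1 (a : R) : measurable_fun setT (shift1 a).
Proof.
have h : @measurable_fun _ _ (measurableTypeR R) R setT idfun by exact: measurable_id.
exact: (@measurable_funD _ (measurableTypeR R) R setT idfun (cst a) h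
    (measurable_cst _)).
Qed.

Lemma measurable_shift2 (d : R * R) : measurable_fun setT (shift2 d).
Proof.
apply: measurable_fun_pair.
  exact: (measurableT_comp (@measurable_shift1 d.1) measurable_fst).
exact: (measurableT_comp (@measurable_shift1 d.2) measurable_snd).
Qed.

Lemma lebesgue_measure_shift (a : R) (A : set (measurableTypeR R)) :
  measurable A -> lebesgue_measure (shift1 a @^-1` A) = lebesgue_measure A.
Proof.
move=> mA.
pose f : {mfun measurableTypeR R >-> measurableTypeR R} :=
  HB.pack (shift1 a) (isMeasurableFun.Build _ _ _ _ _ (@measurable_shift1 a)).
apply/esym/(@lebesgue_measure_unique R (pushforward (@lebesgue_measure R) f)) => //.
move=> X [[b c] _ <-] /=; rewrite /pushforward/=.
have -> : shift1 a @^-1` `]b, c] = `](b - a), (c - a)]%classic.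
  by apply/seteqP; split => x /=; rewrite /shift1 !in_itv/= ltrBlDr lerBrDr.
rewrite !lebesgue_measure_itv/= !lte_fin ltrD2r; case: ifP => // _.
by rewrite -!EFinB; congr (_%:E); ring.
Qed.

(** The image of the product measure under a translation agrees with it on
rectangles, which determines it. *)
Lemma leb2_shift (d : R * R) (A : set (plane R)) : measurable A ->
  leb2 R (shift2 d @^-1` A) = leb2 R A.
Proof.
move=> mA.
pose f : {mfun plane R >-> plane R} :=
  HB.pack (shift2 d) (isMeasurableFun.Build _ _ _ _ _ (@measurable_shift2 d)).
apply/esym/(@product_measure_unique _ _ _ _ R (@lebesgue_measure R) (@lebesgue_measure
    R) (pushforward (leb2 R) f)) => //.
move=> X Y mX mY; rewrite /pushforward/=.
transitivity (leb2 R ((shift1 d.1 @^-1` X) `*` (shift1 d.2 @^-1` Y))) => //.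
have mp (a : R) (Z : set (measurableTypeR R)) : measurable Z ->
    measurable (shift1 a @^-1` Z).
  by move=> mZ; rewrite -[X in measurable X]setTI; exact: measurable_shift1.
rewrite /leb2 product_measure1E//; [|exact: mp|exact: mp].
by congr (_ * _)%E; exact: lebesgue_measure_shift.
Qed.

Lemma ge0_integral_shift2 (d : R * R) (k : plane R -> \bar R) :
  measurable_fun setT k -> (forall x, 0 <= k x)%E ->
  (\int[leb2 R]_x k (shift2 d x) = \int[leb2 R]_x k x)%E.
Proof.
move=> mk k0.
pose f : {mfun plane R >-> plane R} :=
  HB.pack (shift2 d) (isMeasurableFun.Build _ _ _ _ _ (@measurable_shift2 d)).
transitivity (\int[pushforward (leb2 R) f]_x k x)%E.
  by rewrite ge0_integral_pushforward//; exact: measurable_shift2.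
by apply: eq_measure_integral => A mA _; exact: leb2_shift.
Qed.
End shift.
Arguments shift1 {R}.
Arguments shift2 {R}.

Section quadric.
Context (R : realType).

(** Once one root [y1] is known, the equation factors through [y - y1]. *)
Lemma quadratic_finite_roots (a b c : R) :
  (a, b, c) != (0, 0, 0) -> finite_set [set y : R | a * y ^+ 2 + b * y + c = 0].
Proof.
move=> abc0.
have [[y1 /= hy1]|h] := pselect (exists y : R, a * y ^+ 2 + b * y + c = 0); last first.
  rewrite (_ : [set y | _] = set0)//; apply/seteqP; split => // y /= hy.
  by apply: h; exists y.
apply: (@sub_finite_set _ _ ([set y1; - b / a - y1])); last exact: finite_set2.
move=> y /= hy; have : (y - y1) * (a * (y + y1) + b) = 0.
  have -> : (y - y1) * (a * (y + y1) + b) = (a * y ^+ 2 + b * y + c) - (a * y1 ^+ 2 +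
      b * y1 + c) by ring.
  by rewrite hy hy1 subrr.
move/eqP; rewrite mulf_eq0 => /orP[/eqP/subr0_eq|]; first by left.
have [a0|a0] := eqVneq a 0.
  rewrite a0 mul0r add0r => /eqP b0; exfalso.
  by move: abc0; rewrite a0 b0 (_ : c = 0) ?eqxx//; move: hy1; rewrite a0 b0 !mul0r
      !add0r.
rewrite addr_eq0 => /eqP e; right; rewrite -e; field.
by [].
Qed.

Definition quadric (a b c d e f : R) (p : R * R) : R :=
  a * p.2 ^+ 2 + (b + c * p.1) * p.2 + (d + e * p.1 + f * p.1 ^+ 2).

Lemma measurable_fst_plane : @measurable_fun _ _ (plane R) R setT fst.
Proof. exact: measurable_fst. Qed.

Lemma measurable_snd_plane : @measurable_fun _ _ (plane R) R setT snd.
Proof. exact: measurable_snd. Qed.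

Lemma measurable_quadric a b c d e f :
  @measurable_fun _ _ (plane R) R setT (quadric a b c d e f).
Proof.
have m1 := measurable_fst_plane; have m2 := measurable_snd_plane.
repeat (first [exact: measurable_cst | exact: m1 | exact: m2
   | apply: measurable_funD | apply: measurable_funM | apply: measurable_funX]).
Qed.

Lemma measurable_quadric0 a b c d e f :
  @measurable _ (plane R) [set p | quadric a b c d e f p = 0].
Proof.
rewrite (_ : [set p | _] = setT `&` quadric a b c d e f @^-1` [set 0]);
    last by rewrite setTI.
exact: measurable_quadric.
Qed.

(** The vertical section at [x] is the zero set of a quadratic trinomial, which is
finite unless its three coefficients vanish; this happens for finitely many [x]. *)
Lemma quadric_null (a b c d e f : R) (p0 : R * R) :
  quadric a b c d e f p0 != 0 ->
  leb2 R [set p | quadric a b c d e f p = 0] = 0%E.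
Proof.
move=> q0; set N := [set p | _].
have mN : @measurable _ (plane R) N by exact: measurable_quadric0.
pose E := [set x : R | [/\ a = 0, b + c * x = 0 & d + e * x + f * x ^+ 2 = 0]].
have fE : finite_set E.
  have [cb|] := eqVneq (0 : R, c, b) (0, 0, 0); last first.
    move=> /quadratic_finite_roots; apply: sub_finite_set => x [_ h _] /=.
    by rewrite mul0r add0r addrC.
  have [/eqP fed|] := eqVneq (f, e, d) (0, 0, 0); last first.
    move=> /quadratic_finite_roots; apply: sub_finite_set => x [_ _ h] /=.
    by rewrite -h; ring.
  rewrite (_ : E = set0)//; apply/seteqP; split => // x [a0 _ _].
  move: q0; case: cb => -> ->; move: fed; rewrite /quadric a0 => /eqP[-> -> ->].
  by rewrite !(mul0r, addr0) eqxx.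
have nE : lebesgue_measure E = 0%E.
  exact/countable_lebesgue_measure0/finite_set_countable.
rewrite /leb2 /= /product_measure1.
transitivity (\int[@lebesgue_measure R]_x (cst 0 x))%E; last exact: integral0.
apply: ae_eq_integral => //.
  exact: measurable_fun_xsection.
exists E; split => //.
  rewrite (_ : E = setT `&` E) ?setTI//.
  exact/countable_measurable/finite_set_countable.
move=> x /= /not_implyP[_ h]; apply: contrapT => nEx; apply: h.
apply/countable_lebesgue_measure0/finite_set_countable.
have : (a, b + c * x, d + e * x + f * x ^+ 2) != (0, 0, 0).
  by apply/eqP => -[? ? ?]; apply: nEx.
move=> /quadratic_finite_roots; apply: sub_finite_set => y.
by rewrite /xsection/= inE.
Qed.
End quadric.

Section quadrics.
Context (R : realType).

Definition is_affine (l : R * R -> R) := exists al be ga : R,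
  forall x, l x = al + be * x.1 + ga * x.2.

(** Zero sets of such functions cover all the kinks of the competitor; the
predicate spares the computation of the six coefficients. *)
Definition is_quadric (q : R * R -> R) := exists a b c d e f : R,
  forall x, q x = quadric a b c d e f x.

Lemma affine_quadric l : is_affine l -> is_quadric l.
Proof.
move=> [al [be [ga h]]]; exists 0, ga, 0, al, be, 0 => x.
by rewrite h /quadric; ring.
Qed.

Lemma affine_mul l m : is_affine l -> is_affine m -> is_quadric (fun x => l x * m x).
Proof.
move=> [al [be [ga h]]] [al' [be' [ga' h']]].
exists (ga * ga'), (al * ga' + al' * ga), (be * ga' + be' * ga), (al * al'),
  (al * be' + al' * be), (be * be') => x.
by rewrite h h' /quadric; ring.
Qed.

Lemma quadric_add p q : is_quadric p -> is_quadric q -> is_quadric (fun x => p x + q x).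
Proof.
move=> [a [b [c [d [e [f h]]]]]] [a' [b' [c' [d' [e' [f' h']]]]]].
exists (a + a'), (b + b'), (c + c'), (d + d'), (e + e'), (f + f') => x.
by rewrite h h' /quadric; ring.
Qed.

Lemma quadric_scale (k : R) q : is_quadric q -> is_quadric (fun x => k * q x).
Proof.
move=> [a [b [c [d [e [f h]]]]]].
exists (k * a), (k * b), (k * c), (k * d), (k * e), (k * f) => x.
by rewrite h /quadric; ring.
Qed.

Lemma negligible_quadric q (x0 : R * R) : is_quadric q -> q x0 != 0 ->
  (leb2 R).-negligible [set x | q x = 0].
Proof.
move=> [a [b [c [d [e [f h]]]]]]; rewrite h => q0.
have -> : [set x | q x = 0] = [set x | quadric a b c d e f x = 0].
  by apply/seteqP; split => x /=; rewrite h.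
apply/negligibleP; first exact: measurable_quadric0.
exact: quadric_null q0.
Qed.

Lemma open_leb2_gt0 (U : set (R * R)) (x : R * R) : @measurable _ (plane R) U ->
    nbhs x U ->
  (0 < leb2 R U)%E.
Proof.
move=> mU /nbhs_ballP[e /= e0 eU].
pose Q : set (plane R) := (ball x.1 e : set R) `*` (ball x.2 e : set R).
have mb (y : R) : @measurable _ (measurableTypeR R) (ball y e).
  exact: measurable_ball.
have mQ : measurable Q by exact: measurableX.
have QE : leb2 R Q = (lebesgue_measure (ball x.1 e) * lebesgue_measure (ball x.2 e))%E.
  exact: product_measure1E.
have : (leb2 R Q <= leb2 R U)%E.
  by apply: le_measure; rewrite ?inE// => y [? ?]; exact: eU.
apply: lt_le_trans; rewrite QE !lebesgue_measure_ball ?ltW//.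
by rewrite mule_gt0// lte_fin mulrn_wgt0.
Qed.

End quadrics.

(** * Integrals of directional derivatives *)

Section divergence.
Context (R : realType).
Implicit Types (k : R * R -> R) (d : R * R).

(** The difference quotient of [k] in direction [d] with step [1 / (n + 1)]. *)
Definition growth d k (n : nat) (x : R * R) : R :=
  n.+1%:R * (k (x.1 + n.+1%:R^-1 * d.1, x.2 + n.+1%:R^-1 * d.2) - k x).

Definition box (K : R) : set (plane R) := `[-K, K] `*` `[-K, K].

Lemma boxE (K : R) (x : R * R) :
  box K x <-> (- K <= x.1 <= K) /\ (- K <= x.2 <= K).
Proof. by rewrite /box /= !in_itv/=. Qed.

Lemma measurable_box K : measurable (box K).
Proof. exact: measurableX. Qed.

Lemma leb2_box K : (leb2 R (box K) < +oo)%E.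
Proof.
have -> : leb2 R (box K) = (@lebesgue_measure R `[(- K)%R, K] * @lebesgue_measure R
    `[(- K)%R, K])%E.
  exact: product_measure1E.
rewrite !lebesgue_measure_itv/=.
by case: ifP => _; rewrite ?mule0// -EFinB -EFinM ltry.
Qed.

Lemma measurable_growth d k n : @measurable_fun _ _ (plane R) R setT k ->
  @measurable_fun _ _ (plane R) R setT (growth d k n).
Proof.
move=> mk; apply: measurable_funM => //; apply: measurable_funB => //.
pose e := (n.+1%:R^-1 * d.1, n.+1%:R^-1 * d.2).
exact: (measurableT_comp mk (@measurable_shift2 R e)).
Qed.

(** Translations preserve the integral of [k]. *)
Lemma integral_growth0 d k n (C K : R) :
  @measurable_fun _ _ (plane R) R setT k ->
  (forall x, 0 <= k x <= C) -> (forall x : R * R, ~ box K x -> k x = 0) ->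
  (\int[leb2 R]_x (growth d k n x)%:E = 0)%E.
Proof.
move=> mk kC kK; pose e := (n.+1%:R^-1 * d.1, n.+1%:R^-1 * d.2).
pose ks := k \o @shift2 R e.
have mks : @measurable_fun _ _ (plane R) R setT ks.
  exact: (measurableT_comp mk (@measurable_shift2 R e)).
have k0 x : 0 <= k x by case/andP: (kC x).
have iE : (\int[leb2 R]_x (ks x)%:E = \int[leb2 R]_x (k x)%:E)%E.
  have := @ge0_integral_shift2 R e (EFin \o k); apply.
    exact/measurable_EFinP.
  by move=> x; rewrite lee_fin.
have ik : (leb2 R).-integrable setT (EFin \o k).
  have h : (leb2 R).-integrable (box K) (EFin \o k).
    apply: (@le_integrable _ _ _ _ _ _ _ (cst C%:E)) => //.
    - exact: measurable_box.
    - exact/measurable_EFinP/measurable_funTS.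
    - move=> x _ /=; have /andP[? ?] := kC x; rewrite lee_fin !ger0_norm//; lra.
    - apply/integrableP; split => //.
      rewrite integral_cst/=; last exact: measurable_box.
      by apply: lte_mul_pinfty => //; exact: leb2_box.
  have := (integrable_mkcond _ (@measurable_box K)).1 h; congr (_.-integrable _ _).
  apply/funext => x; rewrite patchE; case: ifPn => // /negP; rewrite inE => nx.
  by rewrite /= kK.
have iks : (leb2 R).-integrable setT (EFin \o ks).
  apply/integrableP; split; first exact/measurable_EFinP.
  move/integrableP: ik => [_]; apply: le_lt_trans.
  under [leLHS]eq_integral do rewrite /= ger0_norm ?k0//.
  under [leRHS]eq_integral do rewrite /= ger0_norm ?k0//.
  by rewrite iE.
transitivity (n.+1%:R%:E * (\int[leb2 R]_x ((ks x)%:E - (k x)%:E)))%E.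
  by rewrite -integralZl//; exact: integrableB.
rewrite integralB// iE subee ?mule0//.
by rewrite -(fineK (integrable_fin_num _ ik)).
Qed.

(** The difference quotients have integral 0, are bounded by the Lipschitz constant
and have a common bounded support, so that dominated convergence applies. *)
Lemma integral_directional_derivative0 d k (kd : R * R -> R) (S Z : set (R * R))
    (C K : R) :
  @measurable _ (plane R) S -> @measurable _ (plane R) Z -> Z `<=` S ->
  leb2 R (S `\` Z) = 0%E ->
  @measurable_fun _ _ (plane R) R setT k ->
  (forall x, 0 <= k x <= C) -> (forall x : R * R, ~ box K x -> k x = 0) ->
  (forall n x, `|growth d k n x| <= C) ->
  (forall x, ~ S x -> growth d k ^~ x @ \oo --> 0) ->
  (forall x, Z x -> growth d k ^~ x @ \oo --> kd x) ->
  (leb2 R).-integrable Z (EFin \o kd) /\ (\int[leb2 R]_(x in Z) (kd x)%:E = 0)%E.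
Proof.
move=> mS mZ ZS SZ0 mk kC kK gC gS gZ.
pose a1 : R := `|d.1|; pose a2 : R := `|d.2|.
pose K' := K + a1 + a2.
have mkd : @measurable_fun _ _ (plane R) R Z kd.
  apply: (@measurable_fun_cvg _ (plane R) R Z (growth d k) kd) => // n.
  by apply: measurable_funTS; exact: measurable_growth.
have C0 : 0 <= C by case/andP: (kC 0) => /le_trans; apply.
have gK n (x : R * R) : ~ box K' x -> growth d k n x = 0.
  move=> nx; have i1 : `|n.+1%:R^-1 : R| <= 1.
    by rewrite ger0_norm ?invr_ge0// invf_le1// ler1n.
  have hle (a : R) : `|n.+1%:R^-1 * a| <= `|a| by rewrite normrM ler_piMl.
  have : `|n.+1%:R^-1 * d.1| <= a1 by exact: hle.
  have : `|n.+1%:R^-1 * d.2| <= a2 by exact: hle.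
  have ? : 0 <= a1 by exact: normr_ge0.
  have ? : 0 <= a2 by exact: normr_ge0.
  rewrite /growth; move: (n.+1%:R^-1 * d.1) (n.+1%:R^-1 * d.2) => e1 e2 /ler_normlP[? ?]
      /ler_normlP[? ?].
  rewrite !kK ?subrr ?mulr0//; apply: contra_not nx;
    move=> /boxE/=[/andP[? ?] /andP[? ?]];
    by apply/boxE; rewrite /K'; split; apply/andP; split; lra.
have H := @dominated_convergence _ (plane R) R (leb2 R) setT measurableT
  (fun n => EFin \o growth d k n) ((EFin \o kd) \_ Z)
  ((cst C%:E) \_ (box K')).
have [] := H.
- by move=> n; apply/measurable_EFinP; exact: measurable_growth.
- by apply/(measurable_restrictT _ _).1 => //; exact/measurable_EFinP.
- exists (S `\` Z); split => //; first exact: measurableD.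
  move=> x /= nh; split.
    apply: contrapT => nSx; apply: nh => _; rewrite patchE memNset//.
      by apply/fine_cvgP; split; [exact: nearW|exact: gS].
    by move=> Zx; apply/nSx/ZS.
  move=> Zx; apply: nh => _; rewrite patchE mem_set//=.
  by apply/fine_cvgP; split; [exact: nearW|exact: gZ].
- apply/(integrable_mkcond _ _).1; first exact: measurable_box.
  apply/integrableP; split => //.
  rewrite integral_cst/=; last exact: measurable_box.
  by apply: lte_mul_pinfty => //; exact: leb2_box.
- apply: aeW => x n _; rewrite patchE; case: ifPn => [_|].
    by rewrite /= lee_fin; exact: gC.
  by rewrite notin_setE => /gK /= ->; rewrite normr0.
move=> /= ikd _.
rewrite (_ : (fun n => _) = cst 0%E); last first.
  by apply/funext => n; rewrite /=; exact: integral_growth0 mk kC kK.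
move=> cv; split; first exact/(integrable_mkcond _ _).2.
by rewrite integral_mkcond; apply: (cvg_unique _ cv);
    [exact: ereal_hausdorff|exact: cvg_cst].
Qed.
End divergence.

(** * Plane geometry of the sectors of a disc *)

Section vectors.
Context (R : realType).
Implicit Types (p q x y V : R * R) (a b s t : R).

Definition dot p q : R := p.1 * q.1 + p.2 * q.2.
Definition cross p q : R := p.1 * q.2 - p.2 * q.1.
Definition lerp t p q : R * R := ((1 - t) * p.1 + t * q.1, (1 - t) * p.2 + t * q.2).
Definition dir a : R * R := (cos a, sin a).
Definition diff p q : R * R := (p.1 - q.1, p.2 - q.2).

Lemma dot_dir a : dot (dir a) (dir a) = 1.
Proof. by rewrite /dot/= -!expr2 cos2Dsin2. Qed.

Lemma dot_dir_dir a b : dot (dir a) (dir b) = cos (b - a).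
Proof. by rewrite /dot/= cosB; ring. Qed.

Lemma dot_lerp p t x y : dot p (lerp t x y) = (1 - t) * dot p x + t * dot p y.
Proof. by rewrite /dot /lerp/=; ring. Qed.

Lemma dot_sqr_ge0 p : 0 <= dot p p.
Proof. by rewrite /dot -!expr2 addr_ge0 ?sqr_ge0. Qed.

(** Cauchy-Schwarz, from Lagrange's identity. *)
Lemma dot_sqr_le p q : dot p q ^+ 2 <= dot p p * dot q q.
Proof.
rewrite -subr_ge0.
have -> : dot p p * dot q q - dot p q ^+ 2 = cross p q ^+ 2 by rewrite /dot /cross;
    ring.
exact: sqr_ge0.
Qed.

Lemma cross_sqr_le p q : cross p q ^+ 2 <= dot p p * dot q q.
Proof.
rewrite -subr_ge0.
have -> : dot p p * dot q q - cross p q ^+ 2 = dot p q ^+ 2 by rewrite /dot /cross;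
    ring.
exact: sqr_ge0.
Qed.

Lemma dot_dir_le1 a x : dot x x <= 1 -> dot (dir a) x <= 1.
Proof.
move=> x1; have := dot_sqr_le (dir a) x; rewrite dot_dir mul1r => h.
have {h} : dot (dir a) x ^+ 2 <= 1 by exact: le_trans x1.
by move=> h; nra.
Qed.

Lemma disc_lerp t x y : 0 <= t <= 1 -> dot x x <= 1 -> dot y y <= 1 ->
  dot (lerp t x y) (lerp t x y) <= 1.
Proof.
move=> /andP[t0 t1] x1 y1.
have -> : dot (lerp t x y) (lerp t x y) =
   (1 - t) * dot x x + t * dot y y - t * (1 - t) * dot (diff x y) (diff x y).
  by rewrite /dot /lerp /diff/=; ring.
have h : 0 <= t * (1 - t) * dot (diff x y) (diff x y).
  by rewrite mulr_ge0 ?dot_sqr_ge0// mulr_ge0// subr_ge0.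
have : (1 - t) * dot x x + t * dot y y <= (1 - t) * 1 + t * 1.
  by rewrite lerD ?ler_wpM2l ?subr_ge0.
by move=> h2; lra.
Qed.
End vectors.

Section cone.
Context (R : realType) (V : R * R) (r : R).
Context (r0 : 0 <= r) (r1 : r < 1) (Vr : dot V V = r ^+ 2).
Implicit Types (x : R * R) (a b t : R).

Definition edge a : R * R := diff (dir a) V.
Definition ray t a : R * R := lerp t V (dir a).

Lemma cross_ray_r t a phi :
  cross (edge a) (diff (ray t phi) V) = t * cross (edge a) (edge phi).
Proof. by rewrite /cross /ray /lerp /edge /diff/=; ring. Qed.

Lemma cross_ray_l t a phi :
  cross (diff (ray t phi) V) (edge a) = t * cross (edge phi) (edge a).
Proof. by rewrite /cross /ray /lerp /edge /diff/=; ring. Qed.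

Lemma dot_V_dir a : - r <= dot V (dir a) <= r.
Proof.
have := dot_sqr_le V (dir a); rewrite dot_dir mulr1 Vr => h.
by rewrite -ler_norml -(ler_sqr (normr_ge0 _)) ?nnegrE// real_normK// num_real.
Qed.

Lemma ray_sub t a : diff (ray t a) V = (t * (edge a).1, t * (edge a).2).
Proof. by congr pair; rewrite /=; ring. Qed.

(** With [m] and [h] the mean and the half difference of the angles, both sides
are obtained from the addition formulas and [cos m ^+ 2 + sin m ^+ 2 = 1]. *)
Lemma cross_edge a b : cross (edge a) (edge b) =
  2 * sin ((b - a) / 2) * (cos ((b - a) / 2) - dot V (dir ((a + b) / 2))).
Proof.
have [m [h [-> ->]]] : exists m h, a = m - h /\ b = m + h.
  by exists ((a + b) / 2), ((b - a) / 2); split; field.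
have -> : (m + h - (m - h)) / 2 = h by field.
have -> : (m - h + (m + h)) / 2 = m by field.
have e := cos2Dsin2 m.
rewrite /cross /edge /diff /dot /dir/= !(cosB, sinB, cosD, sinD, cosN, sinN).
have -> : 2 * sin h * (cos h - (V.1 * cos m + V.2 * sin m)) =
  2 * sin h * (cos h * (cos m ^+ 2 + sin m ^+ 2) - (V.1 * cos m + V.2 * sin m)).
  by rewrite e mulr1.
ring.
Qed.

Context (A B : R) (AB : A < B) (ABpi : B - A < pi) (ABr : r < cos (B - A)).

Lemma le_cos (x y : R) : 0 <= x -> x <= y -> y <= pi -> cos y <= cos x.
Proof.
move=> x0 xy ypi.
have ix : x \in `[0, pi] by rewrite in_itv/= x0 (le_trans xy).
have iy : y \in `[0, pi] by rewrite in_itv/= ypi (le_trans x0).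
by rewrite leNgt ltr_cos// -leNgt.
Qed.

Lemma sin_half_gt0 (d : R) : 0 < d -> d <= B - A -> 0 < sin (d / 2).
Proof. by move=> d0 dAB; have ABp := ABpi; apply: sin_gt0_pi; apply/andP; split;
    lra. Qed.

Lemma cos_half_ge (d : R) : `|d| <= B - A -> cos (B - A) <= cos (d / 2).
Proof.
move=> dAB; have e : `|d / 2| = `|d| / 2 by rewrite normrM (@ger0_norm _ (2^-1)).
rewrite -(cos_norm (d / 2)) e; have := normr_ge0 d; move: (`|d|) dAB ABpi => y ? ? ?.
by apply: le_cos; lra.
Qed.

(** On an arc [[A, B]] of length less than [pi] with [r < cos (B - A)], edges turn
counterclockwise as the angle grows; [margin] bounds their rotation from below. *)
Definition margin : R := cos (B - A) - r.

Lemma margin_gt0 : 0 < margin. Proof. by rewrite subr_gt0. Qed.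

(** Half the angle between two points of the arc has cosine at least
[cos (B - A)], so that the last factor in [cross_edge] is at least [margin]. *)
Lemma cross_edge_sqr a b : A <= a <= B -> A <= b <= B ->
  2 * margin ^+ 2 * (1 - cos (b - a)) <= cross (edge a) (edge b) ^+ 2.
Proof.
move=> /andP[Aa aB] /andP[Ab bB]; set d := b - a.
have dAB : `|d| <= B - A by rewrite ler_norml; apply/andP; split; rewrite /d; lra.
have cd := cos_half_ge dAB.
have -> : 1 - cos d = 2 * sin (d / 2) ^+ 2.
  rewrite {1}(_ : d = (d / 2) *+ 2); last by rewrite mulr2n; field.
  by rewrite cos_mulr2n sin2cos2 mulr2n; ring.
rewrite cross_edge -/d; have /andP[_ D] := dot_V_dir ((a + b) / 2).
set D' := cos _ - _; have gD : margin <= D' by rewrite /D' /margin; lra.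
have -> : (2 * sin (d / 2) * D') ^+ 2 = 4 * sin (d / 2) ^+ 2 * D' ^+ 2 by ring.
have -> : 2 * margin ^+ 2 * (2 * sin (d / 2) ^+ 2) = 4 * sin (d / 2) ^+ 2 * margin ^+ 2
    by ring.
apply: ler_wpM2l; first by rewrite mulr_ge0// sqr_ge0.
by rewrite ler_sqr// nnegrE ?(le_trans _ gD)// ltW ?margin_gt0.
Qed.

Lemma cross_edge_gt0 a b : A <= a -> a < b -> b <= B ->
  0 < cross (edge a) (edge b).
Proof.
move=> Aa ab bB; rewrite cross_edge.
have dAB : `|b - a| <= B - A by rewrite ler_norml; apply/andP; split; lra.
have h := cos_half_ge dAB; have rc := ABr; have /andP[_ D] := dot_V_dir ((a + b) / 2).
rewrite mulr_gt0//; last by lra.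
by rewrite mulr_gt0// sin_half_gt0//; lra.
Qed.

Lemma cross_edge_ge0 a b : A <= a -> a <= b -> b <= B ->
  0 <= cross (edge a) (edge b).
Proof.
move=> Aa; rewrite le_eqVlt => /predU1P[->|ab bB]; last exact/ltW/cross_edge_gt0.
by move=> _; rewrite /cross; lra.
Qed.

Lemma edge_sqr a : dot (edge a) (edge a) = 1 + r ^+ 2 - 2 * dot V (dir a).
Proof.
transitivity (dot (dir a) (dir a) + dot V V - 2 * dot V (dir a)).
  by rewrite /dot /edge /diff/=; ring.
by rewrite dot_dir Vr.
Qed.

Lemma edge_sqr_gt0 a : 0 < dot (edge a) (edge a).
Proof. rewrite edge_sqr; have /andP[_ D] := dot_V_dir a; have := r1; nra. Qed.

(** As a polynomial in [t], the left-hand side vanishes at [t = 1], where the ray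
meets the circle. *)
Lemma ray_sqr t a : 1 - dot (ray t a) (ray t a) =
  (1 - t) * (t * dot (edge a) (edge a) + (1 - r ^+ 2)).
Proof.
rewrite edge_sqr -Vr.
have -> : dot (ray t a) (ray t a) = (1 - t) ^+ 2 * dot V V + 2 * t * (1 - t) * dot V
    (dir a) + t ^+ 2 * dot (dir a) (dir a).
  by rewrite /dot /ray /lerp/=; ring.
rewrite dot_dir; ring.
Qed.

Lemma sqr_lt1 : r ^+ 2 < 1.
Proof. by have := r0; have := r1; nra. Qed.

(** The intermediate value theorem turns the two half-plane conditions into an
angle [phi] with [diff x V] parallel to [edge phi]; the conditions then give the
sign of the coefficient [t], and the disc bounds it by 1. *)
Lemma sectorP a b x : A <= a -> a < b -> b <= B ->
  0 <= cross (edge a) (diff x V) -> 0 <= cross (diff x V) (edge b) ->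
  dot x x <= 1 ->
  exists t phi, [/\ 0 <= t <= 1, a <= phi <= b & x = ray t phi].
Proof.
move=> Aa ab bB ca cb x1.
pose h phi := cross (edge phi) (diff x V).
have hc : continuous h.
  move=> phi; rewrite /h /cross /edge /diff /dir/=.
  apply: cvgB; apply: cvgM; try exact: cvg_cst; apply: cvgB; try exact: cvg_cst.
    exact: continuous_cos.
  exact: continuous_sin.
have [||phi /[!in_itv]/= /andP[aphi phib] hphi] := @IVT R h a b 0 (ltW ab).
- exact: continuous_subspaceT.
- have ha : 0 <= h a by exact: ca.
  have hb : h b <= 0.
    by rewrite -oppr_ge0; move: cb; rewrite /h /cross => ?; lra.
  by rewrite ge_min le_max ha hb orbT.
pose E := dot (edge phi) (edge phi).
have E0 : 0 < E by exact: edge_sqr_gt0.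
pose t := dot (diff x V) (edge phi) / E.
have xt : x = ray t phi.
  have e1 : E * (x.1 - V.1) = E * (t * (edge phi).1).
    rewrite /t; have -> : E * (dot (diff x V) (edge phi) / E * (edge phi).1) = dot
        (diff x V) (edge phi) * (edge phi).1.
      by field; rewrite gt_eqF.
    apply/eqP; rewrite -subr_eq0; apply/eqP.
    transitivity (- (edge phi).2 * h phi); last by rewrite hphi mulr0.
    by rewrite /h /cross /E /dot /diff/=; ring.
  have e2 : E * (x.2 - V.2) = E * (t * (edge phi).2).
    rewrite /t; have -> : E * (dot (diff x V) (edge phi) / E * (edge phi).2) = dot
        (diff x V) (edge phi) * (edge phi).2.
      by field; rewrite gt_eqF.
    apply/eqP; rewrite -subr_eq0; apply/eqP.
    transitivity ((edge phi).1 * h phi); last by rewrite hphi mulr0.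
    by rewrite /h /cross /E /dot /diff/=; ring.
  have /mulfI En : E != 0 by rewrite gt_eqF.
  move/En : e1 => e1; move/En : e2 => e2.
  rewrite [x]surjective_pairing; congr pair; rewrite /=.
    by rewrite -[LHS](subrK V.1) e1 /edge/=; ring.
  by rewrite -[LHS](subrK V.2) e2 /edge/=; ring.
exists t, phi; split => //; [|by rewrite aphi].
have cta : cross (edge a) (diff x V) = t * cross (edge a) (edge phi).
  by rewrite xt cross_ray_r.
have ctb : cross (diff x V) (edge b) = t * cross (edge phi) (edge b).
  by rewrite xt cross_ray_l.
have t0 : 0 <= t.
  rewrite leNgt; apply/negP => tn.
  move: ca cb; rewrite cta ctb !nmulr_rge0// => ca' cb'.
  have [aphi'|] := ltP a phi.
    by have := cross_edge_gt0 Aa aphi' (le_trans phib bB); rewrite ltNge ca'.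
  move=> phia; have {phia} phia : phi = a by apply/le_anti; rewrite phia.
  by have := cross_edge_gt0 Aa ab bB; rewrite -{1}phia ltNge cb'.
rewrite t0/= leNgt; apply/negP => t1.
have := ray_sqr t phi; rewrite -xt => e.
have : 0 <= 1 - dot x x by rewrite subr_ge0.
rewrite e leNgt nmulr_rlt0 ?subr_lt0//; apply/negP; rewrite negbK.
by rewrite addr_gt0 ?subr_gt0 ?sqr_lt1// mulr_gt0 ?edge_sqr_gt0 ?(lt_trans _ t1).
Qed.

Lemma ray_sector a b t phi : A <= a -> b <= B -> 0 <= t <= 1 -> a <= phi <= b ->
  [/\ 0 <= cross (edge a) (diff (ray t phi) V),
      0 <= cross (diff (ray t phi) V) (edge b) & dot (ray t phi) (ray t phi) <= 1].
Proof.
move=> Aa bB /andP[t0 t1] /andP[ap pb]; split.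
- by rewrite cross_ray_r mulr_ge0// cross_edge_ge0// (le_trans pb).
- by rewrite cross_ray_l mulr_ge0// cross_edge_ge0// (le_trans Aa).
- rewrite -subr_ge0 ray_sqr mulr_ge0 ?subr_ge0// addr_ge0//.
    by rewrite mulr_ge0// ltW// edge_sqr_gt0.
  by rewrite subr_ge0 ltW// sqr_lt1.
Qed.
End cone.

(** * Tangency to an affine function *)

Section tangency.
Context (R : realType).
Implicit Types (u v : R * R -> R) (x p q d : R * R).

Definition sqdist y x : R := dot (diff y x) (diff y x).

(** First order contact with a quadratic remainder.  It gives all directional
derivatives at once and, unlike differentiability, follows directly from two-sided
bounds on [u]. *)
Definition tangent u x p := exists C : R, \forall y \near x,
  `|u y - u x - dot p (diff y x)| <= C * sqdist y x.

Lemma tangent_line u x p d : tangent u x p -> exists C : R, \forall h \near (0 : R),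
  `|u (x.1 + h * d.1, x.2 + h * d.2) - u x - h * dot p d| <= C * h ^+ 2.
Proof.
move=> [C hC]; exists (C * dot d d).
have c (a b : R) : {for 0, continuous (fun h : R => a + h * b)}.
  by apply: cvgD; [exact: cvg_cst|apply: cvgM; [exact: cvg_id|exact: cvg_cst]].
have cl : {for 0, continuous (fun h : R => (x.1 + h * d.1, x.2 + h * d.2))}.
  exact: (cvg_pair (c x.1 d.1) (c x.2 d.2)).
have hx : (x.1 + 0 * d.1, x.2 + 0 * d.2) = x.
  by case: (x) => ? ?; rewrite !mul0r !addr0.
rewrite -{1}hx in hC.
pose w (h : R) := (x.1 + h * d.1, x.2 + h * d.2).
have H : \forall h \near (0 : R),
    `|u (w h) - u x - dot p (diff (w h) x)| <= C * sqdist (w h) x := cl _ hC.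
rewrite {}/w in H.
apply: filterS H => h /=.
rewrite (_ : dot p _ = h * dot p d); last by rewrite /dot /diff/=; ring.
by move=> /le_trans; apply; rewrite le_eqVlt; apply/orP; left; apply/eqP;
  rewrite /sqdist /dot /diff/=; ring.
Qed.

Lemma tangent_cvg u x p d : tangent u x p ->
  h^-1 * (u (x.1 + h * d.1, x.2 + h * d.2) - u x) @[h --> 0^'] --> dot p d.
Proof.
move=> /(@tangent_line _ _ _ d)[C hC].
apply/cvgrPdist_le => e e0.
have hCe : \forall h \near (0 : R), `|C * h| <= e.
  have cC : {for (0 : R), continuous (fun h : R => `|C * h|)}.
    by apply: cvg_norm; apply: cvgM; [exact: cvg_cst|exact: cvg_id].
  have C0e : `|C * 0| < e by rewrite mulr0 normr0.
  have H : \forall h \near (0 : R), `|C * h| < e := cC _ (lt_nbhsl C0e).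
  by apply: filterS H => h /ltW.
have hCe' : \forall h \near (0 : R)^', `|C * h| <= e by exact: cvg_within hCe.
have hC' : \forall h \near (0 : R)^',
   `|u (x.1 + h * d.1, x.2 + h * d.2) - u x - h * dot p d| <= C * h ^+ 2 by exact:
       cvg_within hC.
near=> h.
have h0 : h != 0 by near: h; exact: nbhs_dnbhs_neq.
have -> : dot p d - h^-1 * (u (x.1 + h * d.1, x.2 + h * d.2) - u x) =
  - (h^-1 * (u (x.1 + h * d.1, x.2 + h * d.2) - u x - h * dot p d)).
  by field.
rewrite normrN normrM; apply: (@le_trans _ _ `|C * h|); last by near: h.
have : `|u (x.1 + h * d.1, x.2 + h * d.2) - u x - h * dot p d| <= C * h ^+ 2 by near: h.
move=> /(ler_wpM2l (normr_ge0 h^-1))/le_trans; apply.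
rewrite -(real_normK (num_real h)) normrV ?unitfE// normrM.
have nh : `|h| != 0 by rewrite normr_eq0.
have -> : `|h|^-1 * (C * `|h| ^+ 2) = C * `|h| by field.
by rewrite ler_wpM2r// ler_norm.
Unshelve. all: by end_near. Qed.

Lemma tangent_derive u x p d : tangent u x p -> 'D_d u x = dot p d.
Proof.
move=> /(@tangent_cvg _ _ _ d); rewrite /derive => H; apply: cvg_lim => //.
apply: cvg_trans H; apply: near_eq_cvg; near=> h => /=.
rewrite /GRing.scale/= (_ : h *: d + x = (x.1 + h * d.1, x.2 + h * d.2))//.
by case: (d) (x) => ? ? [? ?]; congr pair; rewrite /= addrC.
Unshelve. all: by end_near. Qed.

Lemma tangent_growth u x p d : tangent u x p -> growth d u ^~ x @ \oo --> dot p d.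
Proof.
move=> /(@tangent_cvg _ _ _ d) H.
have inv : (n.+1%:R^-1 : R) @[n --> \oo] --> (0 : R)^'.
  have h0 : (n.+1%:R^-1 : R) @[n --> \oo] --> (0 : R) by exact: cvg_harmonic.
  move=> A [e /= e0 eA].
  have H1 : \forall n \near \oo, ball (0 : R) e (n.+1%:R^-1 : R) :=
      h0 _ (nbhsx_ballx (0 : R) e e0).
  apply: filterS H1 => n hn.
  have ne : (n.+1%:R^-1 : R) != 0 by rewrite invr_eq0 pnatr_eq0.
  exact: (eA _ hn ne).
have := cvg_comp _ _ inv H; apply: cvg_trans; apply: near_eq_cvg.
by near=> n; rewrite /growth /= invrK.
Unshelve. all: by end_near. Qed.

Lemma tangent_continuous u x p : tangent u x p -> {for x, continuous u}.
Proof.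
move=> [C hC].
have c1 : {for x, continuous (fst : R * R -> R)} by exact: cvg_fst.
have c2 : {for x, continuous (snd : R * R -> R)} by exact: cvg_snd.
have d0 : diff x x = (0, 0) by rewrite /diff !subrr.
have cD : {for x, continuous (fun y => dot p (diff y x))}.
  by apply: cvgD; apply: cvgM; try exact: cvg_cst; apply: cvgB => //; exact: cvg_cst.
have cS : {for x, continuous (fun y => C * sqdist y x)}.
  apply: cvgM; first exact: cvg_cst.
  by apply: cvgD; apply: cvgM; apply: cvgB => //; exact: cvg_cst.
have e0 : u y - u x - dot p (diff y x) @[y --> x] --> 0.
  apply: norm_cvg0.
  apply: (@squeeze_cvgr _ _ _ _ (cst 0) (fun y => C * sqdist y x)).
  - by apply: filterS hC => y /= ->; rewrite normr_ge0.
  - exact: cvg_cst.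
  - rewrite [X in _ --> X](_ : 0 = C * sqdist x x); first exact: cS.
    by rewrite /sqdist d0 /dot/= !mulr0 addr0 mulr0.
have : (u y - u x - dot p (diff y x)) + dot p (diff y x) + u x @[y --> x] -->
    0 + dot p (diff x x) + u x.
  by apply: cvgD; [apply: cvgD|exact: cvg_cst].
rewrite d0 /dot/= !mulr0 !addr0 add0r /continuous_at; apply: cvg_trans.
by apply: near_eq_cvg; near=> y; rewrite /dot/=; ring.
Unshelve. all: by end_near. Qed.

Lemma tangent_aff p c x : tangent (fun y => dot p y + c) x p.
Proof.
exists 0; near=> y; rewrite mul0r.
by rewrite (_ : _ - _ = 0) ?normr0// /dot /diff/=; ring.
Unshelve. all: by end_near. Qed.

Lemma tangentB u v x p q : tangent u x p -> tangent v x q ->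
  tangent (fun y => u y - v y) x (diff p q).
Proof.
move=> [C hC] [C' hC']; exists (C + C'); near=> y.
have h1 : `|u y - u x - dot p (diff y x)| <= C * sqdist y x by near: y.
have h2 : `|v y - v x - dot q (diff y x)| <= C' * sqdist y x by near: y.
rewrite mulrDl (le_trans _ (lerD h1 h2))//.
rewrite (_ : _ - _ = (u y - u x - dot p (diff y x)) - (v y - v x - dot q (diff y x))).
  exact: ler_normB.
by rewrite /dot /diff/=; ring.
Unshelve. all: by end_near. Qed.

Lemma tangentZ u x p (k : R) : 0 < k -> tangent u x p ->
  tangent (fun y => k * u y) x (k * p.1, k * p.2).
Proof.
move=> k0 [C hC]; exists (k * C); apply: filterS hC => y h.
rewrite (_ : _ - _ = k * (u y - u x - dot p (diff y x))); last by rewrite /dot/=; ring.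
by rewrite normrM gtr0_norm// -mulrA ler_pM2l.
Qed.

Lemma near_eq_tangent u v x p : (\forall y \near x, u y = v y) -> tangent u x p ->
    tangent v x p.
Proof.
move=> uv [C hC]; exists C; have uvx := nbhs_singleton uv.
by apply: filterS2 uv hC => y -> ; rewrite uvx.
Qed.
End tangency.

(** * The gauge of the disc about an interior point *)

Section gauge.
Context (R : realType) (V : R * R) (r : R).
Context (r0 : 0 <= r) (r1 : r < 1) (Vr : dot V V = r ^+ 2).

(** The [t] for which [x] lies at the fraction [t] of the ray from [V] through [x]
to the unit circle: the positive root of the equation in [ray_quadric]. *)
Definition gauge (x : R * R) : R :=
  (dot V (diff x V) + Num.sqrt (dot V (diff x V) ^+ 2 + (1 - r ^+ 2) * sqdist x V)) /
      (1 - r ^+ 2).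

Lemma one_sub_sqr_gt0 : 0 < 1 - r ^+ 2.
Proof. by rewrite subr_gt0 (sqr_lt1 r0 r1). Qed.

Lemma gauge_ray (t phi : R) : 0 <= t -> gauge (ray V t phi) = t.
Proof.
move=> t0; rewrite /gauge ray_sub /sqdist ray_sub.
pose D := dot V (dir phi); have D1 : 0 < 1 - D.
  by have /andP[_ h] := dot_V_dir r0 Vr phi; have := r1; rewrite /D; lra.
have -> : dot V (t * (edge V phi).1, t * (edge V phi).2) = t * (D - r ^+ 2).
  by rewrite -Vr /D /dot /edge/=; ring.
have -> : dot (t * (edge V phi).1, t * (edge V phi).2) (t * (edge V phi).1,
    t * (edge V phi).2) =
    t ^+ 2 * (1 + r ^+ 2 - 2 * D).
  by rewrite -(edge_sqr Vr) /dot/=; ring.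
have -> : (t * (D - r ^+ 2)) ^+ 2 + (1 - r ^+ 2) * (t ^+ 2 * (1 + r ^+ 2 - 2 * D)) =
  (t * (1 - D)) ^+ 2 by ring.
rewrite sqrtr_sqr ger0_norm ?mulr_ge0// ?(ltW D1)//.
by field; rewrite gt_eqF ?one_sub_sqr_gt0.
Qed.

(** For [t != 0], this says that [V + (x - V) / t] lies on the unit circle. *)
Lemma ray_quadric (t phi : R) :
  t ^+ 2 * (1 - r ^+ 2) - 2 * t * dot V (diff (ray V t phi) V) - sqdist (ray V t phi) V
      = 0.
Proof.
rewrite /sqdist ray_sub.
have -> : dot V (t * (edge V phi).1, t * (edge V phi).2) = t * (dot V (dir phi) - r ^+
    2).
  by rewrite -Vr /dot /edge/=; ring.
have -> : dot (t * (edge V phi).1, t * (edge V phi).2) (t * (edge V phi).1,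
    t * (edge V phi).2) =
    t ^+ 2 * (1 + r ^+ 2 - 2 * dot V (dir phi)).
  by rewrite -(edge_sqr Vr) /dot/=; ring.
ring.
Qed.

Lemma measurable_gauge : @measurable_fun _ _ (plane R) R setT gauge.
Proof.
have m1 := @measurable_fst_plane R; have m2 := @measurable_snd_plane R.
have mV : @measurable_fun _ _ (plane R) R setT (fun x => dot V (diff x V)).
  by apply: measurable_funD; apply: measurable_funM => //; apply: measurable_funB.
have ms : @measurable_fun _ _ (plane R) R setT (fun x => sqdist x V).
  by apply: measurable_funD; apply: measurable_funM => //; apply: measurable_funB.
apply: measurable_funM => //; apply: measurable_funD => //.
have mi : @measurable_fun _ _ (plane R) R setT (fun x => dot V (diff x V) ^+ 2 +
    (1 - r ^+ 2) * sqdist x V).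
  apply: measurable_funD; first exact: measurable_funX.
  exact: measurable_funM.
apply: (measurableT_comp _ mi).
apply: continuous_measurable_fun; exact: sqrt_continuous.
Qed.
End gauge.

(** * Convexity and semicontinuity in coordinates *)

Lemma convex_function_lerp (R : realType) (D : set (R * R)) (u : R * R -> R) :
  convex_function D u <-> (forall (t : R) p q, 0 <= t <= 1 -> D p -> D q ->
    u (lerp t p q) <= (1 - t) * u p + t * u q).
Proof.
have E (s : {i01 R}) (p q : convex_lmodType (R * R)%type) :
   conv s p q = lerp (1 - s%:num) p q.
  by rewrite /lerp subKr; case: p q => [p1 p2] [q1 q2]; congr pair; rewrite /=.
split=> [cu t p q t01 Dp Dq|H s p q].
  have t01' : 0 <= 1 - t <= 1 by case/andP: t01 => ? ?; apply/andP; split; lra.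
  pose s := Itv01 (proj1 (andP t01')) (proj2 (andP t01')).
  have := cu s p q (mem_set Dp) (mem_set Dq).
  by rewrite E convRE /= /unstable.onem !subKr.
rewrite !inE => Dp Dq; rewrite convRE E.
have s01 : 0 <= 1 - s%:num <= 1 by rewrite subr_ge0 le1/= lerBlDr lerDl ge0.
by have := H _ p q s01 Dp Dq; rewrite subKr /unstable.onem.
Qed.

(** * The lowered function *)

(** Points off [A] are isolated in the subspace topology, hence impose nothing. *)
Lemma lower_semicontinuous_within (T : topologicalType) (R : realType)
    (A : set T) (f : T -> \bar R) :
  lower_semicontinuous (f : subspace A -> \bar R) <->
  (forall (x : T) (a : R), A x -> (a%:E < f x)%E ->
     nbhs x [set y | A y -> (a%:E < f y)%E]).
Proof.
split=> [lf x a Ax afx|lf x a afx].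
  have [U Ux Ua] := lf x a afx.
  have {Ux} : within A (nbhs (x : T)) U by rewrite (@nbhs_subspace_in T A x Ax).
  by move=> Ux; apply: (filterS _ (Ux : nbhs (x : T) [set y | A y -> U y])) => y h Ay;
    exact: (Ua y (h Ay)).
have [Ax|nAx] := pselect (A x).
  exists [set y | (a%:E < f y)%E]; last by [].
  have : within A (nbhs (x : T)) [set y | (a%:E < f y)%E] by exact: (lf x a Ax afx).
  by rewrite (@nbhs_subspace_in T A x Ax).
exists [set x] => [|y ->//].
have : globally [set x] [set x] by move=> y.
by rewrite (@nbhs_subspace_out T A x nAx).
Qed.

Section contact.
Context (R : realType) (V : R * R) (r : R).
Context (r0 : 0 <= r) (r1 : r < 1) (Vr : dot V V = r ^+ 2).
Context (z : R) (z0 : 0 < z).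

(** The norm of the gradient of the cone along the ray at angle [phi]: there the
gradient is a multiple of [dir phi], because the cone vanishes on the circle, and
the vertex is [z] lower at the distance [1 - dot V (dir phi)] in that direction. *)
Definition slope (phi : R) : R := z / (1 - dot V (dir phi)).

Definition cone_grad (phi : R) : R * R := (slope phi * cos phi, slope phi * sin phi).

Definition aff (p : R * R) (c : R) (x : R * R) : R := dot p x + c.

(** The plane tangent to the cone along the ray at angle [phi]. *)
Definition tplane (phi : R) (x : R * R) : R := slope phi * (dot (dir phi) x - 1).

Lemma dot_V_lt1 (phi : R) : 0 < 1 - dot V (dir phi).
Proof. by have /andP[_ h] := dot_V_dir r0 Vr phi; have := r1; lra. Qed.

Lemma slope_gt0 (phi : R) : 0 < slope phi.
Proof. by rewrite divr_gt0 ?dot_V_lt1. Qed.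

Lemma slopeE (phi : R) : slope phi * (1 - dot V (dir phi)) = z.
Proof. by rewrite /slope divfK// gt_eqF ?dot_V_lt1. Qed.

Lemma aff_lerp p c (t : R) x y : aff p c (lerp t x y) = (1 - t) * aff p c x + t *
    aff p c y.
Proof. by rewrite /aff dot_lerp; ring. Qed.

Lemma tplaneE phi x : tplane phi x =
  aff (cone_grad phi) (- slope phi) x.
Proof. by rewrite /tplane /aff /dot/=; ring. Qed.

Lemma tplaneZE (k phi : R) x :
  aff (k * (cone_grad phi).1, k * (cone_grad phi).2) (- (k * slope phi)) x = k * tplane
      phi x.
Proof. by rewrite tplaneE /aff /dot/=; ring. Qed.

(** Both sides are affine in [t] and agree at the vertex; at [dir psi] the plane
is below the circle by a quantity of second order in [psi - phi]. *)
Lemma tplane_ray (phi t psi : R) : tplane phi (ray V t psi) =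
  - ((1 - t) * z) - t * (slope phi * (1 - cos (psi - phi))).
Proof. by rewrite -(slopeE phi) /tplane dot_lerp dot_dir_dir /dot; ring. Qed.

Lemma tplane_le0 phi x : dot x x <= 1 -> tplane phi x <= 0.
Proof.
move=> x1; rewrite /tplane mulr_ge0_le0//; first exact/ltW/slope_gt0.
by rewrite subr_le0 dot_dir_le1.
Qed.

Context (A B : R) (AB : A < B) (ABpi : B - A < pi) (ABr : r < cos (B - A)).
Context (u : R * R -> R).
Context (ucvx : forall (t : R) p q, 0 <= t <= 1 -> dot p p <= 1 -> dot q q <= 1 ->
  u (lerp t p q) <= (1 - t) * u p + t * u q).
Context (ucone : forall t phi : R, 0 <= t <= 1 -> A <= phi <= B ->
  u (ray V t phi) = - ((1 - t) * z)).

Lemma tplane_cone (phi t psi : R) : 0 <= t <= 1 -> A <= psi <= B ->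
  tplane phi (ray V t psi) <= u (ray V t psi).
Proof.
move=> /andP[t0 t1] psiAB; rewrite ucone ?t0// tplane_ray lerBlDr lerDl.
by rewrite mulr_ge0// mulr_ge0 ?subr_ge0 ?cos_le1// ltW// slope_gt0.
Qed.

Lemma ucone_tplane (t phi : R) : 0 <= t <= 1 -> A <= phi <= B ->
  u (ray V t phi) = tplane phi (ray V t phi).
Proof. by move=> t01 phiAB; rewrite ucone// tplane_ray subrr cos0 subrr !mulr0 subr0.
    Qed.

(** Near the middle of the ray, [u] is the cone, which lies above its tangent plane
and touches it; by convexity a local minimum of the difference is global. *)
Lemma tplane_le (phi : R) x : A < phi < B -> dot x x <= 1 -> tplane phi x <= u x.
Proof.
move=> /andP[Aphi phiB] x1; have half01 : 0 <= (2^-1 : R) <= 1 by apply/andP; split;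
    lra.
pose m := ray V 2^-1 phi.
have phiAB : A <= phi <= B by rewrite !ltW.
have [m1 m2 m3] := ray_sector r0 r1 Vr ABpi ABr (lexx A) (lexx B) half01 phiAB.
have ca : 0 < cross (edge V A) (diff m V).
  by rewrite cross_ray_r mulr_gt0 ?invr_gt0// (cross_edge_gt0 r0 Vr ABpi ABr)// ltW.
have cb : 0 < cross (diff m V) (edge V B).
  by rewrite cross_ray_l mulr_gt0 ?invr_gt0// (cross_edge_gt0 r0 Vr ABpi ABr)// ltW.
(* a positive value stays nonnegative after a small step towards any other *)
have small (p q : R) : 0 < p -> exists2 e0 : R, 0 < e0 & forall e, 0 <= e <= e0 ->
    0 <= (1 - e) * p + e * q.
  move=> p0; exists (p / (p + `|q|)); first by rewrite divr_gt0// ltr_wpDr.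
  move=> e /andP[e0]; rewrite ler_pdivlMr ?ltr_wpDr// => h.
  have : - `|q| <= q by rewrite lerNnormlW.
  by move=> ?; nra.
have [e1 e10 he1] := small _ (cross (edge V A) (diff x V)) ca.
have [e2 e20 he2] := small _ (cross (diff x V) (edge V B)) cb.
pose e := Num.min (Num.min e1 e2) 1.
have e0 : 0 < e by rewrite !lt_min e10 e20 ltr01.
have e01 : 0 <= e <= 1 by rewrite (ltW e0) ge_min lexx orbT.
pose y := lerp e m x.
have y1 : dot y y <= 1 by exact: disc_lerp.
have [||t [psi [t01 psiAB yE]]] := sectorP r0 r1 Vr ABpi ABr (lexx A) AB (lexx B) _ _
    y1.
- have -> : cross (edge V A) (diff y V) = (1 - e) * cross (edge V A) (diff m V) + e *
    cross (edge V A) (diff x V).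
    by rewrite /cross /diff /y /lerp/=; ring.
  by apply: he1; rewrite (ltW e0)/= !ge_min lexx.
- have -> : cross (diff y V) (edge V B) = (1 - e) * cross (diff m V) (edge V B) + e *
    cross (diff x V) (edge V B).
    by rewrite /cross /diff /y /lerp/=; ring.
  by apply: he2; rewrite (ltW e0)/= !ge_min lexx orbT.
have yle : tplane phi y <= u y by rewrite yE; exact: tplane_cone.
have key : tplane phi y = (1 - e) * tplane phi m + e * tplane phi x.
  by rewrite !tplaneE aff_lerp.
have um : u m = tplane phi m by exact: ucone_tplane.
have uy := ucvx e01 m3 x1.
rewrite -(ler_pM2l e0) -(lerD2l ((1 - e) * tplane phi m)) -key (le_trans yle)//.
by rewrite -um.
Qed.

Context (a b : R) (Aa : A < a) (ab : a < b) (bB : b < B).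

(** Nonnegative exactly on the closed sector between the angles [a] and [b], and
zero exactly on its boundary, which makes boundary crossings accessible to the
intermediate value theorem. *)
Definition depth x : R :=
  Num.min (Num.min (cross (edge V a) (diff x V)) (cross (diff x V) (edge V b)))
    (1 - dot x x).

Lemma depth_ge0P x : 0 <= depth x <->
  exists t phi, [/\ 0 <= t <= 1, a <= phi <= b & x = ray V t phi].
Proof.
split.
  rewrite /depth !le_min (subr_ge0 (dot x x)) => /andP[/andP[? ?] ?].
  by apply: (sectorP r0 r1 Vr ABpi ABr (ltW Aa) ab (ltW bB)) => //.
move=> [t [phi [t01 phiab ->]]]; rewrite /depth !le_min (subr_ge0 (dot _ _)).
have [h1 h2 h3] := ray_sector r0 r1 Vr ABpi ABr (ltW Aa) (ltW bB) t01 phiab.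
by rewrite h1 h2 h3.
Qed.

Lemma arc_interior phi : a <= phi <= b -> A < phi < B.
Proof.
by move=> /andP[? ?]; rewrite (lt_le_trans Aa)// (le_lt_trans _ bB).
Qed.

Lemma arc_sub phi : a <= phi <= b -> A <= phi <= B.
Proof. by move=> /arc_interior/andP[? ?]; rewrite !ltW. Qed.

Lemma depth_disc x : 0 <= depth x -> dot x x <= 1.
Proof. by rewrite /depth le_min (subr_ge0 (dot x x)) => /andP[]. Qed.

Context (M : R) (uM : forall x, dot x x <= 1 -> - M <= u x <= 0).
Context (kap : R) (kap1 : 1 < kap).

Definition lowered x : R :=
  if 0 <= depth x then Num.max (Num.max (tplane a x) (tplane b x)) (kap * u x)
  else u x.

(** The affine functions of which [lowered] is the maximum on the sector.  On the
ray at angle [phi], the cone [kap * u] agrees with the plane [kap * tplane phi]. *)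
Definition piece p c := exists2 phi, a <= phi <= b &
  [\/ aff p c =1 tplane a, aff p c =1 tplane b | aff p c =1 (fun x => kap * tplane phi
      x)].

Lemma tplane_le_ab phi x : a <= phi <= b -> dot x x <= 1 -> tplane phi x <= u x.
Proof. by move=> /arc_interior; exact: tplane_le. Qed.

Lemma kap_gt0 : 0 < kap. Proof. exact: lt_trans kap1. Qed.

Lemma kap_le (w : R) : w <= 0 -> kap * w <= w.
Proof. by have := kap1; nra. Qed.

Lemma left_end : a <= a <= b. Proof. by rewrite lexx ltW. Qed.
Lemma right_end : a <= b <= b. Proof. by rewrite lexx ltW. Qed.

Lemma lowered_le x : dot x x <= 1 -> lowered x <= u x.
Proof.
move=> x1; rewrite /lowered; case: ifP => // _.
rewrite !ge_max !tplane_le_ab ?left_end ?right_end//= kap_le//.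
by case/andP: (uM x1).
Qed.

(** Outside the sector the planes are below [u] by convexity of [u], and the scaled
ones even more so because they are nonpositive. *)
Lemma piece_le p c x : piece p c -> dot x x <= 1 -> aff p c x <= lowered x.
Proof.
move=> [phi phiab pc] x1; rewrite /lowered; case: ifP => d.
  case: pc => ->; rewrite !le_max.
  - by rewrite lexx.
  - by rewrite lexx orbT.
  - by rewrite (ler_pM2l kap_gt0) tplane_le_ab// orbT.
case: pc => ->; [exact: (tplane_le_ab left_end)|exact: (tplane_le_ab right_end)|].
by apply: le_trans (tplane_le_ab phiab x1); rewrite kap_le// tplane_le0.
Qed.

Lemma piece_active x : 0 <= depth x ->
  exists p c, piece p c /\ lowered x = aff p c x.
Proof.
move=> d; have [t [phi [t01 phiab xE]]] := (depth_ge0P x).1 d.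
rewrite /lowered d; case: leP => _; last first.
  case: leP => _.
    by exists (cone_grad b), (- slope b); split;
      [exists a; [exact: left_end|apply: Or32 => y; rewrite tplaneE]|rewrite tplaneE].
  by exists (cone_grad a), (- slope a); split;
      [exists a; [exact: left_end|apply: Or31 => y; rewrite tplaneE]|rewrite tplaneE].
exists (kap * (cone_grad phi).1, kap * (cone_grad phi).2), (- (kap * slope phi)).
split; first by exists phi => //; apply: Or33 => y; rewrite tplaneZE.
by rewrite tplaneZE xE ucone_tplane//; exact: arc_sub.
Qed.

(** On an edge of the sector the tangent plane along this edge equals [u]; on the
arc a scaled tangent plane and [u] both vanish. *)
Lemma contact x : depth x = 0 ->
  exists p c, [/\ piece p c, aff p c x = u x & lowered x = u x].
Proof.
move=> d; have d0 : 0 <= depth x by rewrite d.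
have x1 := depth_disc d0.
have [t [phi [t01 phiab xE]]] := (depth_ge0P x).1 d0.
suff [p [c [pc pcx]]] : exists p c, piece p c /\ aff p c x = u x.
  exists p, c; split => //; apply/le_anti; rewrite lowered_le//= -pcx.
  exact: piece_le.
have h psi : a <= psi <= b -> x = ray V t psi -> tplane psi x = u x.
  by move=> psiab ->; rewrite ucone_tplane//; exact: arc_sub.
have ha : x = ray V t a -> exists p c, piece p c /\ aff p c x = u x.
  move=> xa; exists (cone_grad a), (- slope a); rewrite -tplaneE.
  split; last by apply: h => //; exact: left_end.
  by exists a; [exact: left_end|apply: Or31 => y; rewrite tplaneE].
have hb : x = ray V t b -> exists p c, piece p c /\ aff p c x = u x.
  move=> xb; exists (cone_grad b), (- slope b); rewrite -tplaneE.
  split; last by apply: h => //; exact: right_end.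
  by exists a; [exact: left_end|apply: Or32 => y; rewrite tplaneE].
have t0r psi : t = 0 -> x = ray V t psi.
  by move=> t0; rewrite xE t0 /ray /lerp/= !mul0r !addr0.
have [tn0|tn0] := eqVneq t 0; first exact/ha/t0r.
have tp : 0 < t by rewrite lt_neqAle eq_sym tn0; case/andP: t01.
have phiAB := arc_sub phiab; case/andP: phiab (phiab) => aphi phib phiab.
move: d; rewrite /depth {1 2}xE.
rewrite cross_ray_r.
rewrite cross_ray_l.
move: aphi; rewrite le_eqVlt => /predU1P[aphi|aphi]; first by move=> _; apply: ha;
    rewrite aphi.
move: phib; rewrite le_eqVlt => /predU1P[phib|phib]; first by move=> _; apply: hb;
    rewrite -phib.
have ca : 0 < t * cross (edge V a) (edge V phi).
  by rewrite mulr_gt0// (cross_edge_gt0 r0 Vr ABpi ABr)// ?(ltW Aa)//; case/andP: phiAB.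
have cb : 0 < t * cross (edge V phi) (edge V b).
  by rewrite mulr_gt0// (cross_edge_gt0 r0 Vr ABpi ABr)// ?(ltW bB)//; case/andP: phiAB.
have cab0 : 0 < Num.min (t * cross (edge V a) (edge V phi)) (t * cross (edge V phi)
    (edge V b)).
  by rewrite lt_min ca.
move=> d; have : 1 - dot x x = 0.
  move: d; set m := Num.min _ _ in cab0 *; case: leP => // _ m0.
  by move: cab0; rewrite m0 ltxx.
rewrite xE (ray_sqr Vr) => /eqP; rewrite mulf_eq0 => /orP[|]; last first.
  rewrite gt_eqF// addr_gt0// ?subr_gt0 ?(sqr_lt1 r0 r1)//.
  by rewrite mulr_gt0// (edge_sqr_gt0 r0 r1 Vr).
rewrite subr_eq0 => /eqP t1.
exists (kap * (cone_grad phi).1, kap * (cone_grad phi).2), (- (kap * slope phi)).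
split; first by exists phi => //; apply: Or33 => y; rewrite tplaneZE.
by rewrite tplaneZE -ucone_tplane// ucone// -t1 subrr mul0r oppr0 mulr0.
Qed.

Lemma lowered_out x : depth x < 0 -> lowered x = u x.
Proof. by rewrite /lowered leNgt => ->. Qed.

(** The lower bound comes from the first tangent plane: on the sector it is at least
[- z], the value of [u] at the vertex. *)
Lemma lowered_range x : dot x x <= 1 -> - M <= lowered x <= 0.
Proof.
move=> x1; have /andP[uM1 u0] := uM x1.
rewrite (le_trans (lowered_le x1) u0) andbT.
have [d|d] := leP 0 (depth x); last by rewrite lowered_out.
have [t [phi [t01 phiab xE]]] := (depth_ge0P x).1 d.
(* the value at the vertex *)
have zM : z <= M.
  have V1 : dot V V <= 1 by rewrite Vr ltW// (sqr_lt1 r0 r1).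
  have ABA : A <= A <= B by rewrite lexx ltW.
  have t00 : 0 <= (0 : R) <= 1 by rewrite lexx ler01.
  have := ucone t00 ABA; rewrite subr0 mul1r.
  have -> : ray V 0 A = V by case: (V) => ? ?; rewrite /ray /lerp/= subr0 !mul1r !mul0r
      !addr0.
  by move=> uV; have := uM V1; rewrite uV lerN2 => /andP[].
rewrite (le_trans (y := tplane a x))//; last first.
  by rewrite /lowered d !le_max lexx.
rewrite xE tplane_ray -opprD lerN2 (le_trans _ zM)//.
have h : slope a * (1 - cos (phi - a)) <= z.
  rewrite -[leRHS](slopeE a) ler_pM2l ?slope_gt0// lerD2l lerN2.
  have /andP[_ /le_trans] := dot_V_dir r0 Vr a; apply; apply: (le_trans (ltW ABr)).
  have := AB; have := Aa; have := bB; have := ABpi; case/andP: phiab => ? ? ? ? ? ?.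
  by apply: le_cos; lra.
move: h; case/andP: t01; move: (_ * _) => h t0 t1 hz.
by have : t * h <= t * z by [exact: ler_wpM2l]; move=> ?; lra.
Qed.

Lemma continuous_depth : continuous depth.
Proof.
move=> x; have c1 : {for x, continuous (fst : R * R -> R)} by exact: cvg_fst.
have c2 : {for x, continuous (snd : R * R -> R)} by exact: cvg_snd.
pose f1 y := cross (edge V a) (diff y V); pose f2 y := cross (diff y V) (edge V b).
pose f3 (y : R * R) : R := 1 - dot y y.
have h1 : {for x, continuous f1}.
  by apply: cvgB; apply: cvgM; try exact: cvg_cst; apply: cvgB => //; exact: cvg_cst.
have h2 : {for x, continuous f2}.
  by apply: cvgB; apply: cvgM; try exact: cvg_cst; apply: cvgB => //; exact: cvg_cst.
have h3 : {for x, continuous f3}.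
  by apply: cvgB; [exact: cvg_cst|apply: cvgD; apply: cvgM].
exact: (continuous_min (continuous_min h1 h2) h3).
Qed.

Lemma continuous_lerp (p q : R * R) : continuous (fun t : R => lerp t p q).
Proof.
move=> t; have c1 : (1 - s) @[s --> t] --> 1 - t.
  by apply: cvgB; [exact: cvg_cst|exact: cvg_id].
have c2 : s @[s --> t] --> t by exact: cvg_id.
have h (x y : R) : {for t, continuous (fun s : R => (1 - s) * x + s * y)}.
  by apply: cvgD; apply: cvgM => //; exact: cvg_cst.
exact: (cvg_pair (h p.1 q.1) (h p.2 q.2)).
Qed.

Lemma depth_crossing (p q : R * R) : 0 <= depth p -> depth q < 0 ->
  exists2 t, 0 <= t < 1 & depth (lerp t p q) = 0.
Proof.
move=> dp dq; have e0 : lerp 0 p q = p.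
  by case: p {dp} => ? ?; rewrite /lerp/= subr0 !mul1r !mul0r !addr0.
have e1 : lerp 1 p q = q.
  by case: q {e0 dq} => ? ?; rewrite /lerp/= subrr !mul1r !mul0r !add0r.
have [||t /[!in_itv]/= /andP[t0 t1] ht] := @IVT R (fun t => depth (lerp t p q)) 0 1 0
    ler01.
- apply: continuous_subspaceT => t; 
  apply: (@continuous_comp _ _ _ (fun t => lerp t p q) depth);
      first exact: continuous_lerp.
  exact: continuous_depth.
- by rewrite e0 e1 ge_min le_max dp (ltW dq) orbT.
exists t => //; rewrite t0/= lt_neqAle t1 andbT; apply/eqP => t1'.
by move: ht; rewrite t1' e1 => dq0; move: dq; rewrite dq0 ltxx.
Qed.

Lemma lerpC (t : R) (p q : R * R) : lerp t p q = lerp (1 - t) q p.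
Proof. by rewrite /lerp; congr pair; ring. Qed.

(** The segment leaves the sector at a point [w] before it reaches [m].  Beyond [w]
the function is [u], which is convex, and at [w] it equals a piece, which lies
below the chord from [p] to [q]. *)
Lemma lowered_convex_out (t : R) p q : 0 <= t <= 1 ->
  dot p p <= 1 -> dot q q <= 1 -> 0 <= depth p -> depth q < 0 ->
  depth (lerp t p q) < 0 ->
  lowered (lerp t p q) <= (1 - t) * lowered p + t * lowered q.
Proof.
move=> t01 p1 q1 dp dq dm; have m1 := disc_lerp t01 p1 q1.
have [tau /andP[tau0 tau1] dr] := depth_crossing dp dm.
pose m := lerp t p q; pose w := lerp tau p m.
have [g [c [gc gw lw]]] := contact dr.
have tt1 : tau * t < 1 by case/andP: t01 => ? ?; nra.
(* the parameter of the point between [w] and [q] *)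
pose s := (t - tau * t) / (1 - tau * t).
have s1 : 1 - s = (1 - t) / (1 - tau * t) by rewrite /s; field;
    rewrite gt_eqF// subr_gt0.
have s01 : 0 <= s <= 1.
  have /andP[t0 t1] := t01; apply/andP; split.
    by rewrite divr_ge0 ?subr_ge0 ?(ltW tt1)// ler_piMl// ltW.
  by rewrite -subr_ge0 s1 divr_ge0// subr_ge0 // ltW.
have mE : m = lerp s w q.
  rewrite /m /w /m /lerp/= s1 /s; congr pair; field; rewrite gt_eqF// subr_gt0//.
have w1 : dot w w <= 1 by apply: depth_disc; rewrite dr.
have := ucvx s01 w1 q1; rewrite -mE (lowered_out dm) (lowered_out dq) -/m.
rewrite -gw; move=> /le_trans; apply.
have -> : aff g c w = (1 - tau * t) * aff g c p + tau * t * aff g c q.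
  rewrite /w /m !aff_lerp; ring.
have hp : aff g c p <= lowered p by exact: piece_le.
have hq : aff g c q <= u q by rewrite -(lowered_out dq); exact: piece_le.
have := t01 => /andP[t0 t1].
apply: (@le_trans _ _ ((1 - s) * ((1 - tau * t) * lowered p + tau * t * u q) + s *
    u q)).
  rewrite lerD2r ler_wpM2l//; first by rewrite subr_ge0; case/andP: s01.
  apply: lerD; apply: ler_wpM2l => //; first by rewrite subr_ge0 ltW.
  exact: mulr_ge0.
rewrite le_eqVlt; apply/orP; left; apply/eqP.
rewrite s1 /s; field; rewrite gt_eqF// subr_gt0//.
Qed.

(** At a point of the sector the active piece is an affine support, which gives the
inequality for every segment through this point. *)
Lemma lowered_convex (t : R) p q : 0 <= t <= 1 -> dot p p <= 1 -> dot q q <= 1 ->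
  lowered (lerp t p q) <= (1 - t) * lowered p + t * lowered q.
Proof.
move=> t01 p1 q1; have /andP[t0 t1] := t01.
have [dm|dm] := leP 0 (depth (lerp t p q)).
  have [g [c [gc ->]]] := piece_active dm.
  have hp := piece_le gc p1; have hq := piece_le gc q1.
  by rewrite aff_lerp; apply: lerD; apply: ler_wpM2l => //; rewrite subr_ge0.
have [dp|dp] := leP 0 (depth p); have [dq|dq] := leP 0 (depth q).
- suff : 0 <= depth (lerp t p q) by rewrite leNgt dm.
  move: dp dq; rewrite /depth !le_min !(subr_ge0 (dot _ _)).
  move=> /andP[/andP[pa pb] _] /andP[/andP[qa qb] _]; rewrite disc_lerp// andbT;
      apply/andP; split.
    have -> : cross (edge V a) (diff (lerp t p q) V) = (1 - t) * cross (edge V a)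
        (diff p V) + t * cross (edge V a) (diff q V).
      by rewrite /cross /diff /lerp/=; ring.
    by rewrite addr_ge0// mulr_ge0// subr_ge0.
  have -> : cross (diff (lerp t p q) V) (edge V b) = (1 - t) * cross (diff p V)
      (edge V b) + t * cross (diff q V) (edge V b).
    by rewrite /cross /diff /lerp/=; ring.
  by rewrite addr_ge0// mulr_ge0// subr_ge0.
- exact: lowered_convex_out.
- have t01' : 0 <= 1 - t <= 1 by apply/andP; split; lra.
  have := @lowered_convex_out (1 - t) q p t01' q1 p1 dq dp.
  by rewrite -lerpC subKr [leRHS]addrC; apply.
- by rewrite !lowered_out//; exact: ucvx.
Qed.

(** In the sector, the active piece is a continuous minorant. *)
Lemma lowered_lsc :
  lower_semicontinuous ((fun p => (u p)%:E) : subspace (@unit_disc R) -> \bar R) ->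
  lower_semicontinuous ((fun p => (lowered p)%:E) : subspace (@unit_disc R) -> \bar R).
Proof.
move=> /lower_semicontinuous_within lu; apply/lower_semicontinuous_within => x al Dx.
rewrite lte_fin => alx.
have [dx|dx] := leP 0 (depth x).
  have [g [c [gc gx]]] := piece_active dx.
  have cg : {for x, continuous (aff g c)}.
    apply: cvgD; last exact: cvg_cst.
    by apply: cvgD; apply: cvgM; try exact: cvg_cst; [exact: cvg_fst|exact: cvg_snd].
  have al' : al < aff g c x by rewrite -gx.
  have Ux : nbhs x [set y | al < aff g c y] := cg _ (lt_nbhsr al').
  apply: filterS Ux => y /= ay Dy.
  by rewrite lte_fin (lt_le_trans ay)// piece_le.
have := lu x al Dx; rewrite lte_fin -(lowered_out dx) => /(_ alx) Ux.
have dU : nbhs x [set y | depth y < 0] := continuous_depth (lt_nbhsl dx).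
apply: filterS2 Ux dU => y /= h dy Dy.
by rewrite lowered_out//; exact: h.
Qed.


Lemma depth_gt0 x : 0 < depth x -> exists t phi,
  [/\ 0 < t < 1, a < phi < b & x = ray V t phi].
Proof.
move=> d; have [t [phi [/andP[t0 t1] /andP[aphi phib] xE]]] := (depth_ge0P x).1 (ltW d).
exists t, phi; move: d; rewrite /depth !lt_min (subr_gt0 (dot _ _)) -andbA xE.
rewrite cross_ray_r.
rewrite cross_ray_l.
move=> /and3P[ca cb c1].
have e0 psi : cross (edge V psi) (edge V psi) = 0 by rewrite /cross; ring.
split => //; apply/andP; split.
- rewrite lt_neqAle t0 andbT; apply/eqP => t0'.
  by move: ca; rewrite -t0' mul0r ltxx.
- rewrite lt_neqAle t1 andbT; apply/eqP => t1'.
  by move: c1; rewrite -subr_gt0 (ray_sqr Vr) t1' subrr mul0r ltxx.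
- rewrite lt_neqAle aphi andbT; apply/eqP => h.
  by move: ca; rewrite -h e0 mulr0 ltxx.
- rewrite lt_neqAle phib andbT; apply/eqP => h.
  by move: cb; rewrite h e0 mulr0 ltxx.
Qed.

Lemma near_depth x : 0 < depth x -> \forall y \near x, 0 < depth y.
Proof. by move=> d; have := @continuous_depth x _ (lt_nbhsr d). Qed.

Lemma near_depthN x : depth x < 0 -> \forall y \near x, depth y < 0.
Proof. by move=> d; have := @continuous_depth x _ (lt_nbhsl d). Qed.

(** If [y] lies on the ray at angle [psi], then [u y] exceeds the plane tangent along
the ray at [phi] by a multiple of [1 - cos (psi - phi)], and [cross_edge_sqr] bounds
this angle by the distance of [y] to that ray. *)
Lemma u_tangent (t phi : R) : 0 < t <= 1 -> a <= phi <= b ->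
  0 < depth (ray V t phi) -> tangent u (ray V t phi) (cone_grad phi).
Proof.
move=> /andP[t0 t1] phiab dx; set x := ray V t phi in dx *.
have phiAB := arc_sub phiab.
pose E := dot (edge V phi) (edge V phi).
have E0 : 0 < E by exact: (edge_sqr_gt0 r0 r1 Vr).
have t01 : 0 <= t <= 1 by rewrite (ltW t0) t1.
pose sig := t ^+ 2 * E / 2.
have sig0 : 0 < sig by rewrite divr_gt0// mulr_gt0// exprn_gt0.
have g0 : 0 < margin r A B := margin_gt0 ABr.
exists (2 * slope phi * E / (margin r A B ^+ 2 * sig)).
have c1 : {for x, continuous (fst : R * R -> R)} by exact: cvg_fst.
have c2 : {for x, continuous (snd : R * R -> R)} by exact: cvg_snd.
have cV : {for x, continuous (fun y => sqdist y V)}.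
  by apply: cvgD; apply: cvgM; apply: cvgB => //; exact: cvg_cst.
have xV : sqdist x V = t ^+ 2 * E.
  by rewrite /sqdist /x ray_sub /E /dot/=; ring.
have sigx : sig < sqdist x V.
  by rewrite xV /sig ltr_pdivrMr// ltr_pMr ?ltr1n// mulr_gt0// exprn_gt0.
have near1 : \forall y \near x, sig < sqdist y V := cV _ (lt_nbhsr sigx).
apply: filterS2 near1 (near_depth dx) => y sy dy.
have [s [psi [/andP[s0 s1] psiab yE]]] := (depth_ge0P y).1 (ltW dy).
have psiAB := arc_sub psiab.
have s01 : 0 <= s <= 1 by rewrite s0 s1.
have -> : u y - u x - dot (cone_grad phi) (diff y x) = s *
    (slope phi * (1 - cos (psi - phi))).
  have -> : dot (cone_grad phi) (diff y x) = tplane phi y - tplane phi x.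
    by rewrite !tplaneE /aff /dot /cone_grad/=; ring.
  rewrite (_ : u x = tplane phi x); last exact: ucone_tplane.
  by rewrite yE ucone// tplane_ray; ring.
have c0 : 0 <= 1 - cos (psi - phi) by rewrite subr_ge0 cos_le1.
have sl := slope_gt0 phi.
have sl0 := ltW sl.
have pos : 0 <= s * (slope phi * (1 - cos (psi - phi))).
  by apply: mulr_ge0 => //; apply: mulr_ge0.
rewrite (ger0_norm pos).
have key : s ^+ 2 * (2 * margin r A B ^+ 2 * (1 - cos (psi - phi))) <= E * sqdist y x.
  have h1 := cross_edge_sqr r0 Vr ABpi ABr phiAB psiAB.
  apply: (le_trans (ler_wpM2l (sqr_ge0 s) h1)).
  rewrite -exprMn (_ : s * _ = cross (edge V phi) (diff y x));
      first exact: cross_sqr_le.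
  transitivity (cross (edge V phi) (diff y V) - cross (edge V phi) (diff x V));
      last first.
    by rewrite /cross/=; ring.
  by rewrite yE /x !ray_sub /cross/=; ring.
(* [s] stays away from 0, as the edges have length at most 2 *)
have s4 : sig <= 4 * s.
  have : sqdist y V = s ^+ 2 * dot (edge V psi) (edge V psi).
    by rewrite /sqdist yE ray_sub /dot/=; ring.
  rewrite (edge_sqr Vr); have /andP[D1 D2] := dot_V_dir r0 Vr psi.
  have := r0; have := r1 => ? ? h.
  have : s ^+ 2 * (1 + r ^+ 2 - 2 * dot V (dir psi)) <= s * 4.
    apply: ler_pM => //; rewrite ?sqr_ge0 ?expr2 ?ler_piMr//; nra.
  by rewrite -h => ?; have := ltW sy; lra.
have gs0 : 0 < margin r A B ^+ 2 * sig by rewrite mulr_gt0// exprn_gt0.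
rewrite [leRHS]mulrAC ler_pdivlMr//.
apply: (@le_trans _ _ (2 * slope phi * (s ^+ 2 * (2 * margin r A B ^+ 2 *
    (1 - cos (psi - phi)))))); last first.
  by rewrite -(mulrA _ E) ler_pM2l// mulr_gt0.
have -> : s * (slope phi * (1 - cos (psi - phi))) * (margin r A B ^+ 2 * sig) =
  (s * slope phi * (1 - cos (psi - phi)) * margin r A B ^+ 2) * sig by ring.
have -> : 2 * slope phi * (s ^+ 2 * (2 * margin r A B ^+ 2 * (1 - cos (psi - phi)))) =
  (s * slope phi * (1 - cos (psi - phi)) * margin r A B ^+ 2) * (4 * s) by ring.
by apply: ler_wpM2l => //; rewrite mulr_ge0 ?sqr_ge0// mulr_ge0// mulr_ge0.
Qed.

(** The interior of the sector without the points where two of the three functions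
in the maximum coincide. *)
Definition regular_part := [set x | [/\ 0 < depth x, tplane a x != tplane b x,
  tplane a x != kap * u x & tplane b x != kap * u x]].

Lemma near_lt (f g : R * R -> R) x : {for x, continuous f} -> {for x, continuous g} ->
  f x < g x -> \forall y \near x, f y < g y.
Proof.
move=> cf cg fg; have cgf : {for x, continuous (fun y => g y - f y)} by exact: cvgB.
have gf0 : 0 < g x - f x by rewrite subr_gt0.
have H : \forall y \near x, 0 < g y - f y := cgf _ (lt_nbhsr gf0).
by apply: filterS H => y; rewrite subr_gt0.
Qed.

Lemma tplane_tangent phi x : tangent (tplane phi) x (cone_grad phi).
Proof.
have := tangent_aff (cone_grad phi) (- slope phi) x; apply: near_eq_tangent.
by near=> y; rewrite tplaneE.
Unshelve. all: by end_near. Qed.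

Lemma lowered_tangent x (p : R * R) : regular_part x -> tangent u x p ->
  exists q, [/\ tangent lowered x q,
    tangent (fun y => Num.max (Num.max (tplane a y) (tplane b y)) (kap * u y)) x q &
    [\/ q = cone_grad a, q = cone_grad b | q = (kap * p.1, kap * p.2)]].
Proof.
move=> [dx ab_neq au_neq bu_neq] up.
suff [q [h qE]] : exists q, tangent (fun y => Num.max (Num.max (tplane a y)
    (tplane b y)) (kap * u y)) x q /\ [\/ q = cone_grad a, q = cone_grad b | q =
    (kap * p.1, kap * p.2)].
  exists q; split => //; apply: near_eq_tangent h.
  by apply: filterS (near_depth dx) => y /ltW dy; rewrite /lowered dy.
have ca := tangent_continuous (tplane_tangent a x).
have cb := tangent_continuous (tplane_tangent b x).
have ku := tangentZ kap_gt0 up; have cu := tangent_continuous ku.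
have case1 : Num.max (tplane a x) (tplane b x) < kap * u x ->
    tangent (fun y => Num.max (Num.max (tplane a y) (tplane b y)) (kap * u y)) x
        (kap * p.1, kap * p.2).
  rewrite gt_max => /andP[ua ub]; apply: near_eq_tangent ku.
  apply: filterS2 (near_lt ca cu ua) (near_lt cb cu ub) => y ua' ub'.
  by apply/esym/max_idPr; rewrite ge_max !ltW.
have case2 : tplane b x < tplane a x -> kap * u x < tplane a x ->
    tangent (fun y => Num.max (Num.max (tplane a y) (tplane b y)) (kap * u y)) x
        (cone_grad a).
  move=> ba ua; apply: near_eq_tangent (tplane_tangent a x).
  apply: filterS2 (near_lt cb ca ba) (near_lt cu ca ua) => y ba' ua'.
  by rewrite (max_idPl (ltW ba')) (max_idPl (ltW ua')).
have case3 : tplane a x < tplane b x -> kap * u x < tplane b x ->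
    tangent (fun y => Num.max (Num.max (tplane a y) (tplane b y)) (kap * u y)) x
        (cone_grad b).
  move=> ba ua; apply: near_eq_tangent (tplane_tangent b x).
  apply: filterS2 (near_lt ca cb ba) (near_lt cu cb ua) => y ba' ua'.
  by rewrite (max_idPr (ltW ba')) (max_idPl (ltW ua')).
have [uab|abu] := ltP (Num.max (tplane a x) (tplane b x)) (kap * u x).
  by exists (kap * p.1, kap * p.2); split; [exact: case1|exact: Or33].
have [lab|lab|/eqP] := ltgtP (tplane a x) (tplane b x); last by rewrite (negbTE ab_neq).
  exists (cone_grad b); split; last exact: Or32.
  apply: case3 => //; rewrite lt_neqAle eq_sym bu_neq/=.
  by move: abu; rewrite (max_idPr (ltW lab)).
exists (cone_grad a); split; last exact: Or31.
apply: case2 => //; rewrite lt_neqAle eq_sym au_neq/=.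
by move: abu; rewrite (max_idPl (ltW lab)).
Qed.

Definition dip x : R := if 0 <= depth x then u x - lowered x else 0.

Definition dist1 (x y : R * R) : R := `|x.1 - y.1| + `|x.2 - y.2|.

Definition max_slope : R := z / (1 - r).

Lemma slope_le phi : slope phi <= max_slope.
Proof.
rewrite /slope /max_slope ler_pM2l// lef_pV2 ?posrE ?dot_V_lt1 ?subr_gt0//.
by rewrite lerD2l lerN2; have /andP[] := dot_V_dir r0 Vr phi.
Qed.

Lemma max_slope_gt0 : 0 < max_slope.
Proof. exact: lt_le_trans (slope_gt0 0) (slope_le 0). Qed.

Lemma dist1_ge0 x y : 0 <= dist1 x y.
Proof. by rewrite addr_ge0. Qed.

Lemma dist1C x y : dist1 x y = dist1 y x.
Proof. by rewrite /dist1 distrC (distrC x.2). Qed.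

Lemma tplane_lip phi x y : `|tplane phi x - tplane phi y| <= max_slope * dist1 x y.
Proof.
have -> : tplane phi x - tplane phi y =
  slope phi * (cos phi * (x.1 - y.1) + sin phi * (x.2 - y.2)).
  by rewrite /tplane /dot/=; ring.
rewrite normrM (gtr0_norm (slope_gt0 phi)); apply: ler_pM => //.
- exact/ltW/slope_gt0.
- exact: slope_le.
- apply: (le_trans (ler_normD _ _)); rewrite !normrM.
  by apply: lerD; rewrite ler_piMl// ?cos_max ?sin_max.
Qed.

Lemma u_lip x y : 0 <= depth x -> 0 <= depth y -> `|u x - u y| <= max_slope * dist1 x y.
Proof.
suff H (p q : R * R) : 0 <= depth p -> 0 <= depth q -> u p - u q <= max_slope * dist1 p
    q.
  by move=> dx dy; apply/ler_normlP; rewrite opprB {1}dist1C; split; exact: H.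
move=> dp dq; have [t [phi [t01 phiab pE]]] := (depth_ge0P p).1 dp.
have [s [psi [s01 psiab qE]]] := (depth_ge0P q).1 dq.
have -> : u p = tplane phi p by rewrite pE ucone_tplane//; exact: arc_sub.
have : tplane phi q <= u q by rewrite qE; apply: tplane_cone => //; exact: arc_sub.
have := tplane_lip phi p q; rewrite ler_norml => /andP[_ h1] h2.
by rewrite (le_trans _ h1)// lerB.
Qed.

Lemma max_lip (c p p' q q' : R) : `|p - p'| <= c -> `|q - q'| <= c ->
  `|Num.max p q - Num.max p' q'| <= c.
Proof.
rewrite !ler_norml => /andP[? ?] /andP[? ?].
by case: (leP p q) => ?; case: (leP p' q') => ?; apply/andP; split; lra.
Qed.

Lemma lowered_lip x y : 0 <= depth x -> 0 <= depth y ->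
  `|lowered x - lowered y| <= kap * (max_slope * dist1 x y).
Proof.
move=> dx dy; rewrite /lowered dx dy.
have c0 : 0 <= max_slope * dist1 x y by rewrite mulr_ge0 ?dist1_ge0// ltW//
    max_slope_gt0.
have c1 : max_slope * dist1 x y <= kap * (max_slope * dist1 x y) by rewrite ler_peMl//
    ltW.
apply: max_lip; first by apply: max_lip; apply: le_trans c1; exact: tplane_lip.
by rewrite -mulrBr normrM (gtr0_norm kap_gt0) (ler_pM2l kap_gt0) u_lip.
Qed.

Lemma dip_contact x : depth x = 0 -> dip x = 0.
Proof.
by move=> d; have [p [c [_ _ lx]]] := contact d; rewrite /dip lx subrr; case: ifP.
Qed.

(** A segment that leaves the sector crosses its boundary, where the dip is 0; so
the Lipschitz bound inside the sector suffices. *)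
Lemma dip_lip x y : `|dip x - dip y| <= (1 + kap) * (max_slope * dist1 x y).
Proof.
have H p q : 0 <= depth p -> 0 <= depth q ->
    `|dip p - dip q| <= (1 + kap) * (max_slope * dist1 p q).
  move=> dp dq; rewrite /dip dp dq.
  rewrite (_ : _ - _ = (u p - u q) - (lowered p - lowered q)); last by ring.
  rewrite mulrDl mul1r (le_trans (ler_normB _ _))//.
  by rewrite lerD ?u_lip ?lowered_lip.
have C0 : 0 <= (1 + kap) * max_slope.
  by rewrite mulr_ge0 ?addr_ge0//; [exact/ltW/kap_gt0|exact/ltW/max_slope_gt0].
have H' p q : 0 <= depth p -> depth q < 0 ->
    `|dip p - dip q| <= (1 + kap) * (max_slope * dist1 p q).
  move=> dp dq; have [t /andP[t0 t1] dt] := depth_crossing dp dq.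
  have -> : dip q = dip (lerp t p q) by rewrite (dip_contact dt) /dip leNgt dq.
  apply: (le_trans (H _ _ dp _)); first by rewrite dt.
  rewrite [leLHS]mulrA [leRHS]mulrA ler_wpM2l//.
  have -> : dist1 p (lerp t p q) = t * dist1 p q.
    rewrite /dist1 /lerp/=.
    have -> : p.1 - ((1 - t) * p.1 + t * q.1) = t * (p.1 - q.1) by ring.
    have -> : p.2 - ((1 - t) * p.2 + t * q.2) = t * (p.2 - q.2) by ring.
    by rewrite !normrM (ger0_norm t0) mulrDr.
  by rewrite ler_piMl ?dist1_ge0// ltW.
have [dx|dx] := leP 0 (depth x); have [dy|dy] := leP 0 (depth y).
- exact: H.
- exact: H'.
- by rewrite distrC dist1C H'.
- have -> : dip x = 0 by rewrite /dip leNgt dx.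
  have -> : dip y = 0 by rewrite /dip leNgt dy.
  by rewrite subrr normr0 [leRHS]mulrA mulr_ge0 ?dist1_ge0.
Qed.

Lemma dip_growth d n x :
  `|growth d dip n x| <= (1 + kap) * max_slope * (`|d.1| + `|d.2|).
Proof.
rewrite /growth normrM; have n0 : 0 < (n.+1%:R : R) by rewrite ltr0n.
rewrite (gtr0_norm n0) -ler_pdivlMl//; apply: (le_trans (dip_lip _ _)).
rewrite /dist1/= (addrC x.1) addrK (addrC x.2) addrK !normrM.
rewrite (@ger0_norm _ n.+1%:R^-1) ?invr_ge0 ?ler0n// -mulrDr.
by rewrite le_eqVlt; apply/orP; left; apply/eqP; ring.
Qed.

Lemma dip_range x : 0 <= dip x <= M.
Proof.
rewrite /dip; case: ifP => d.
  have x1 := depth_disc d; have /andP[? ?] := uM x1.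
  have /andP[? ?] := lowered_range x1; have := lowered_le x1.
  by move=> ?; apply/andP; split; lra.
have V1 : dot V V <= 1 by rewrite Vr ltW// (sqr_lt1 r0 r1).
by have /andP[? ?] := uM V1; rewrite lexx/=; lra.
Qed.

Lemma dip_box x : ~ box 1 x -> dip x = 0.
Proof.
move=> nx; rewrite /dip; case: ifP => // d; exfalso; apply: nx; apply/boxE.
have := depth_disc d; rewrite /dot => h.
have h1 := sqr_ge0 x.1; have h2 := sqr_ge0 x.2; rewrite !expr2 in h1 h2.
by split; apply/andP; split; nra.
Qed.


(** A total and measurable function that agrees with [u] on the sector. *)
Definition cone_height x : R := - z + z * gauge V r x.

Lemma u_cone_height x : 0 <= depth x -> u x = cone_height x.
Proof.
move=> d; have [t [phi [t01 phiab ->]]] := (depth_ge0P x).1 d.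
rewrite ucone//; last exact: arc_sub.
by rewrite /cone_height (gauge_ray r0 r1 Vr)//; [ring|case/andP: t01].
Qed.

Lemma measurable_cone_height : @measurable_fun _ _ (plane R) R setT cone_height.
Proof.
apply: measurable_funD => //; apply: measurable_funM => //.
exact: measurable_gauge.
Qed.

Lemma measurable_tplane phi : @measurable_fun _ _ (plane R) R setT (tplane phi).
Proof.
have m1 := @measurable_fst_plane R; have m2 := @measurable_snd_plane R.
apply: measurable_funM => //; apply: measurable_funB => //.
by apply: measurable_funD; apply: measurable_funM.
Qed.

Lemma measurable_depth : @measurable_fun _ _ (plane R) R setT depth.
Proof.
have m1 := @measurable_fst_plane R; have m2 := @measurable_snd_plane R.
apply: measurable_minr; first apply: measurable_minr.
- by apply: measurable_funB; apply: measurable_funM => //; apply: measurable_funB.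
- by apply: measurable_funB; apply: measurable_funM => //; apply: measurable_funB.
- by apply: measurable_funB => //; apply: measurable_funD; apply: measurable_funM.
Qed.

Definition lowered_height x : R := Num.max (Num.max (tplane a x) (tplane b x))
    (kap * cone_height x).

Lemma measurable_lowered_height : @measurable_fun _ _ (plane R) R setT lowered_height.
Proof.
apply: measurable_maxr; first by apply: measurable_maxr; exact: measurable_tplane.
by apply: measurable_funM => //; exact: measurable_cone_height.
Qed.

Definition sector : set (R * R) := [set x | 0 <= depth x].

Lemma measurable_boolset (f : R * R -> bool) :
  @measurable_fun _ _ (plane R) bool setT f -> @measurable _ (plane R) [set x | f x].
Proof.
move=> mf; rewrite (_ : [set x | f x] = setT `&` f @^-1` [set true]).
  exact: mf.
by rewrite setTI; apply/seteqP; split=> x /=.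
Qed.

Lemma measurable_sector : @measurable _ (plane R) sector.
Proof.
apply: (@measurable_boolset (fun x => 0 <= depth x)).
by apply: measurable_fun_ler => //; exact: measurable_depth.
Qed.

Lemma measurable_disc : @measurable _ (plane R) (@unit_disc R).
Proof.
have m1 := @measurable_fst_plane R; have m2 := @measurable_snd_plane R.
apply: (@measurable_boolset (fun x => x.1 ^+ 2 + x.2 ^+ 2 <= 1)).
apply: measurable_fun_ler => //.
by apply: measurable_funD; apply: measurable_funX.
Qed.

Lemma measurable_regular_part : @measurable _ (plane R) regular_part.
Proof.
have mt := measurable_tplane; have mk : @measurable_fun _ _ (plane R) R setT (fun x =>
    kap * cone_height x).
  by apply: measurable_funM => //; exact: measurable_cone_height.
pose f x := [&& 0 < depth x, tplane a x != tplane b x,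
  tplane a x != kap * cone_height x & tplane b x != kap * cone_height x].
have -> : regular_part = [set x | f x].
  apply/seteqP; split => x.
    by move=> [d h1 h2 h3]; rewrite /f/= d h1 -u_cone_height ?h2 ?h3// ltW.
  by rewrite /f /= => /and4P[d h1 h2 h3]; split; rewrite ?u_cone_height// ltW.
apply: measurable_boolset; apply: measurable_and.
  by apply: measurable_fun_ltr => //; exact: measurable_depth.
by apply: measurable_and; [|apply: measurable_and];
  apply: measurable_neg; apply: measurable_fun_eqr.
Qed.

Lemma affine_tplane phi : is_affine (tplane phi).
Proof.
exists (- slope phi), (slope phi * cos phi), (slope phi * sin phi) => x.
by rewrite /tplane /dot/=; ring.
Qed.

Lemma affine_edge phi (k : R) : is_affine (fun x => k * cross (edge V phi) (diff x V)).
Proof.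
exists (k * ((edge V phi).2 * V.1 - (edge V phi).1 * V.2)), (- k * (edge V phi).2),
    (k * (edge V phi).1) => x.
by rewrite /cross/=; ring.
Qed.

(** At a point of the ray with parameter [t] the equation says that [t] is an affine
function [T] of the point.  Putting it into the equation of the gauge gives a
quadratic polynomial, which does not vanish at the vertex since [kap] is not 1. *)
Lemma negligible_kink phi : (leb2 R).-negligible
  [set x | 0 <= depth x /\ tplane phi x = kap * u x].
Proof.
pose T x := 1 + (kap * z)^-1 * tplane phi x.
have kz : kap * z != 0 by rewrite mulf_neq0 ?gt_eqF ?kap_gt0.
have aT : is_affine T.
  have [al [be [ga h]]] := affine_tplane phi.
  exists (1 + (kap * z)^-1 * al), ((kap * z)^-1 * be), ((kap * z)^-1 * ga) => x.
  by rewrite /T h; ring.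
have aV : is_affine (fun x => dot V (diff x V)).
  by exists (- dot V V), V.1, V.2 => x; rewrite /dot/=; ring.
have a1 : is_affine (fun x => (diff x V).1).
  by exists (- V.1), 1, 0 => x /=; ring.
have a2 : is_affine (fun x => (diff x V).2).
  by exists (- V.2), 0, 1 => x /=; ring.
pose q x := (1 - r ^+ 2) * (T x * T x) + (-2 * (T x * dot V (diff x V)) +
  (-1 * ((diff x V).1 * (diff x V).1) + -1 * ((diff x V).2 * (diff x V).2))).
have qq : is_quadric q.
  apply: quadric_add; first exact/quadric_scale/affine_mul.
  apply: quadric_add; first exact/quadric_scale/affine_mul.
  by apply: quadric_add; exact/quadric_scale/affine_mul.
apply: (negligibleS _ (negligible_quadric (x0 := V) qq _)).
  move=> x [dx tu] /=; have [t [psi [t01 psiab xE]]] := (depth_ge0P x).1 dx.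
  have Tt : T x = t.
    rewrite /T tu xE ucone//; last exact: arc_sub.
    by field; rewrite ?gt_eqF ?kap_gt0.
  rewrite /q Tt xE -[RHS](ray_quadric Vr t psi) /sqdist /dot; ring.
have TV : T V = 1 - kap^-1.
  rewrite /T /tplane (_ : dot (dir phi) V = dot V (dir phi)); last by rewrite /dot;
      ring.
  have -> : slope phi * (dot V (dir phi) - 1) = - z by rewrite -(slopeE phi); ring.
  by field; rewrite ?gt_eqF ?kap_gt0.
rewrite /q TV /diff /dot/= !subrr !(mulr0, addr0) mulf_neq0//.
  by rewrite gt_eqF ?(one_sub_sqr_gt0 r0 r1).
by rewrite mulf_neq0// subr_eq0 eq_sym invr_eq1 gt_eqF.
Qed.

Lemma kinks_null : leb2 R (sector `\` regular_part) = 0%E.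
Proof.
apply/negligibleP; first by apply: measurableD;
    [exact: measurable_sector|exact: measurable_regular_part].
have edge_neq phi (k : R) : k != 0 ->
    (leb2 R).-negligible [set x | k * cross (edge V phi) (diff x V) = 0].
  move=> k0; apply: (negligible_quadric (x0 := (V.1 - (edge V phi).2,
      V.2 + (edge V phi).1)));
    first exact/affine_quadric/affine_edge.
  rewrite (_ : cross _ _ = dot (edge V phi) (edge V phi)); last by rewrite /cross
      /dot/=; ring.
  by rewrite mulf_neq0// gt_eqF ?(edge_sqr_gt0 r0 r1 Vr).
have na := edge_neq a 1 (oner_neq0 _).
have nb : (leb2 R).-negligible [set x | -1 * cross (edge V b) (diff x V) = 0].
  by apply: edge_neq; rewrite oppr_eq0 oner_neq0.
have nc : (leb2 R).-negligible [set x : R * R | 1 - dot x x = 0].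
  apply: (negligible_quadric (x0 := (0, 0))).
    by exists (-1), 0, 0, 1, 0, (-1) => x; rewrite /dot /quadric; ring.
  by rewrite /dot/= !mul0r addr0 subr0 oner_neq0.
have nt : (leb2 R).-negligible [set x | tplane a x - tplane b x = 0].
  apply: (negligible_quadric (x0 := dir a)).
    have [al [be [ga h]]] := affine_tplane a.
    have [al' [be' [ga' h']]] := affine_tplane b.
    apply: affine_quadric; exists (al - al'), (be - be'), (ga - ga') => x.
    by rewrite h h'; ring.
  rewrite /tplane dot_dir dot_dir_dir subrr mulr0 sub0r oppr_eq0 mulf_neq0//.
    by rewrite gt_eqF ?slope_gt0.
  rewrite subr_eq0 -cosN opprB lt_eqF//.
  have h : b - a <= B - A by have := Aa; have := bB; lra.
  rewrite -cos0 ltr_cos ?in_itv/= ?lexx ?pi_ge0 ?subr_gt0//.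
  by rewrite subr_ge0 (ltW ab)/= (le_trans h)// ltW.
have U := negligibleU (negligibleU (negligibleU na nb) (negligibleU nc nt))
  (negligibleU (negligible_kink a) (negligible_kink b)).
apply: negligibleS U => x [dx ncell].
have [ca|ca] := eqVneq (1 * cross (edge V a) (diff x V)) 0; first by left; left; left.
have [cb|cb] := eqVneq (-1 * cross (edge V b) (diff x V)) 0; first by left; left; right.
have [cc|cc] := eqVneq (1 - dot x x) 0; first by left; right; left.
have [ct|ct] := eqVneq (tplane a x - tplane b x) 0; first by left; right; right.
have [ka|ka] := eqVneq (tplane a x) (kap * u x); first by right; left.
have [kb|kb] := eqVneq (tplane b x) (kap * u x); first by right; right.
exfalso; apply: ncell; split => //; last by rewrite -subr_eq0.
have cb' : -1 * cross (edge V b) (diff x V) = cross (diff x V) (edge V b).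
  by rewrite /cross/=; ring.
rewrite cb' in cb; rewrite mul1r in ca.
move: dx; rewrite /sector/= /depth !le_min !lt_min => /andP[/andP[da db] dc].
by rewrite !lt_neqAle da db dc !(eq_sym 0) ca cb cc.
Qed.

Lemma leb2_disc : (leb2 R (@unit_disc R) < +oo)%E.
Proof.
apply: (le_lt_trans _ (@leb2_box R 1)); apply: le_measure; rewrite ?inE.
- exact: measurable_disc.
- exact: measurable_box.
- move=> x h; apply/boxE; rewrite /unit_disc/= in h.
  have h1 := sqr_ge0 x.1; have h2 := sqr_ge0 x.2.
  by split; apply/andP; split; nra.
Qed.

Lemma sector_disc x : sector x -> unit_disc x.
Proof. exact: depth_disc. Qed.

Lemma regular_part_sector : regular_part `<=` sector.
Proof. by move=> x [/ltW]. Qed.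

Lemma leb2_regular_part_gt0 : (0 < leb2 R regular_part)%E.
Proof.
pose mid := (a + b) / 2.
have midab : a < mid < b by rewrite /mid; have := ab => ?; apply/andP; split; lra.
have [t [d0 t01]] : exists t : R, 0 < depth (ray V t mid) /\ 0 < t.
  exists 2^-1; split; last by rewrite invr_gt0.
  rewrite /depth !lt_min (subr_gt0 (dot _ _)) -andbA.
  rewrite cross_ray_r.
  rewrite cross_ray_l.
  have /andP[am mb] := midab.
  rewrite !mulr_gt0 ?invr_gt0//; last 2 first.
  - by rewrite (cross_edge_gt0 r0 Vr ABpi ABr)// ?(ltW bB)// (le_trans (ltW Aa))// ltW.
  - by rewrite (cross_edge_gt0 r0 Vr ABpi ABr)// ?(ltW Aa)// (le_trans (ltW mb))// ltW.
  rewrite -subr_gt0 (ray_sqr Vr) mulr_gt0//.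
    by have : (2^-1 : R) < 1 by [rewrite invf_lt1// ltr1n]; rewrite subr_gt0.
  by rewrite addr_gt0 ?(one_sub_sqr_gt0 r0 r1)// mulr_gt0 ?invr_gt0//
      (edge_sqr_gt0 r0 r1 Vr).
have S0 : (0 < leb2 R sector)%E.
  apply: (open_leb2_gt0 measurable_sector (x := ray V t mid)).
  by apply: filterS (near_depth d0) => y /ltW.
have : (leb2 R sector <= leb2 R regular_part)%E.
  rewrite -[leRHS]adde0 -kinks_null -measureU//; first last.
  - by apply/seteqP; split => // x [? [_]].
  - by apply: measurableD; [exact: measurable_sector|exact: measurable_regular_part].
  - exact: measurable_regular_part.
  apply: le_measure; rewrite ?inE; first exact: measurable_sector.
    by apply: measurableU; [|apply: measurableD]; try exact: measurable_regular_part;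
        exact: measurable_sector.
  by move=> x Sx; have [?|?] := pselect (regular_part x); [left|right].
exact: lt_le_trans.
Qed.

(** The integrand of the resistance as a function of the gradient. *)
Definition resist (p : R * R) : R := (p.1 ^+ 2 + p.2 ^+ 2 + 1)^-1.

Lemma sqr_grad_tangent w x p : tangent w x p -> (sqr_grad w x + 1)^-1 = resist p.
Proof.
move=> wp; rewrite /sqr_grad (tangent_derive (1, 0) wp) (tangent_derive (0, 1) wp).
by rewrite /dot/= !mulr0 !mulr1 addr0 add0r.
Qed.

Lemma regular_part_tangent x : regular_part x -> exists2 phi, a < phi < b & tangent u x
    (cone_grad phi).
Proof.
move=> [d _ _ _]; have [t [phi [/andP[t0 t1] phiab xE]]] := depth_gt0 d.
exists phi => //; rewrite xE; apply: u_tangent; rewrite -?xE//; first by rewrite t0 ltW.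
by case/andP: phiab => ? ?; rewrite !ltW.
Qed.

(** [w] is only known to be measurable through [w'], which agrees with it to first
order on the regular part. *)
Lemma measurable_derive (w w' : R * R -> R) d : @measurable_fun _ _ (plane R) R setT w'
    ->
  (forall x, regular_part x -> exists p, tangent w x p /\ tangent w' x p) ->
  @measurable_fun _ _ (plane R) R regular_part (fun x => 'D_d w x).
Proof.
move=> mw' H.
apply: (@measurable_fun_cvg _ (plane R) R regular_part (growth d w')).
  by move=> n; apply: measurable_funTS; exact: measurable_growth.
move=> x /H[p [wp wp']]; rewrite (tangent_derive d wp); exact: tangent_growth.
Qed.

Lemma measurable_resist (w w' : R * R -> R) : @measurable_fun _ _ (plane R) R setT w' ->
  (forall x, regular_part x -> exists p, tangent w x p /\ tangent w' x p) ->
  @measurable_fun _ _ (plane R) R regular_part (fun x => (sqr_grad w x + 1)^-1).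
Proof.
move=> mw' H.
have ms : @measurable_fun _ _ (plane R) R regular_part (fun x => sqr_grad w x).
  by apply: measurable_funD; apply: measurable_funX; exact: measurable_derive mw' H.
(* the absolute value makes the function continuous on the whole line *)
have ci : continuous (fun y : R => (`|y| + 1)^-1).
  move=> y; apply: cvgV; first by rewrite gt_eqF// ltr_wpDl.
  by apply: cvgD; [exact: norm_continuous|exact: cvg_cst].
have := measurableT_comp (continuous_measurable_fun ci) ms.
apply: eq_measurable_fun => x _ /=; congr ((_ + 1)^-1).
by rewrite ger0_norm// /sqr_grad addr_ge0 ?sqr_ge0.
Qed.

(** On the regular part the hypotheses say that the gain in the integrand exceeds the
derivative of [- dip] in the direction [d], whose integral vanishes. *)
Lemma lowered_resistance (d : R * R) (al0 : R) :
  (forall phi, a < phi < b -> al0 < resist (cone_grad phi) + dot (cone_grad phi) d) ->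
  resist (cone_grad a) + dot (cone_grad a) d <= al0 ->
  resist (cone_grad b) + dot (cone_grad b) d <= al0 ->
  (forall phi, a < phi < b ->
    resist (kap * (cone_grad phi).1, kap * (cone_grad phi).2) + kap * dot
        (cone_grad phi) d <= al0) ->
  (newton_resistance lowered < newton_resistance u)%E.
Proof.
move=> Hu Ha Hb Hk.
have tu x : regular_part x -> exists p, tangent u x p /\ tangent cone_height x p.
  move=> cx; have [phi _ up] := regular_part_tangent cx; exists (cone_grad phi);
      split => //.
  case: cx => dx _ _ _; apply: near_eq_tangent up.
  by apply: filterS (near_depth dx) => y /ltW; exact: u_cone_height.
have tl x : regular_part x -> exists p, tangent lowered x p /\ tangent lowered_height x
    p.
  move=> cx; have [phi _ up] := regular_part_tangent cx.
  have [q [lq wq _]] := lowered_tangent cx up; exists q; split => //.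
  case: cx => dx _ _ _; apply: near_eq_tangent wq.
  by apply: filterS (near_depth dx) => y /ltW/u_cone_height; rewrite /lowered_height =>
      ->.
pose kd x := 'D_d u x - 'D_d lowered x.
have near_dip x : regular_part x -> forall p q, tangent u x p -> tangent lowered x q ->
    tangent dip x (diff p q).
  move=> [dx _ _ _] p q up lq; apply: near_eq_tangent (tangentB up lq).
  by apply: filterS (near_depth dx) => y /ltW dy; rewrite /dip dy.
have mdip : @measurable_fun _ _ (plane R) R setT dip.
  have -> : dip = (fun x => if 0 <= depth x then cone_height x - lowered_height x else
      0).
    apply/funext => x; rewrite /dip; case: ifP => // dx.
    by rewrite /lowered dx /lowered_height !u_cone_height.
  apply: measurable_fun_ifT => //.
    by apply: measurable_fun_ler => //; exact: measurable_depth.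
  by apply: measurable_funB; [exact: measurable_cone_height|exact:
      measurable_lowered_height].
have [C [hC1 hC2]] : exists C, (forall x, 0 <= dip x <= C) /\ (forall n x,
    `|growth d dip n x| <= C).
  exists (Num.max M ((1 + kap) * max_slope * (`|d.1| + `|d.2|))); split.
    by move=> x; have /andP[-> h] := dip_range x; rewrite le_max h.
  by move=> n x; rewrite le_max dip_growth orbT.
have [ikd kd0] : (leb2 R).-integrable regular_part (EFin \o kd) /\
    (\int[leb2 R]_(x in regular_part) (kd x)%:E = 0)%E.
  apply: (@integral_directional_derivative0 R d dip kd sector regular_part C 1) => //.
  - exact: measurable_sector.
  - exact: measurable_regular_part.
  - exact: regular_part_sector.
  - exact: kinks_null.
  - exact: dip_box.
  - move=> x nS; have dx : depth x < 0 by rewrite ltNge; apply/negP.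
    have := @tangent_growth R dip x (0, 0) d; rewrite (_ : dot (0, 0) d = 0);
        last by rewrite /dot/= !mul0r addr0.
    apply; apply: near_eq_tangent (tangent_aff (0, 0) 0 x).
    by apply: filterS (near_depthN dx) => y dy; rewrite /dip leNgt dy /dot/= !mul0r
        !addr0.
  - move=> x cx; have [p [up _]] := tu x cx; have [q [lq _]] := tl x cx.
    rewrite /kd (tangent_derive d up) (tangent_derive d lq).
    rewrite (_ : _ - _ = dot (diff p q) d); last by rewrite /dot/=; ring.
    exact/tangent_growth/near_dip.
have inv_ge0 (w : R * R -> R) x : 0 <= (sqr_grad w x + 1)^-1.
  by rewrite invr_ge0 addr_ge0// /sqr_grad addr_ge0// sqr_ge0.
have inv_le1 (w : R * R -> R) x : (sqr_grad w x + 1)^-1 <= 1.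
  have h : 0 <= sqr_grad w x by rewrite /sqr_grad addr_ge0// sqr_ge0.
  by rewrite invf_le1 ?lerDr// ltr_wpDl.
have DS : (@unit_disc R `\` sector) `|` regular_part `<=` @unit_disc R.
  by move=> x [[]//|/regular_part_sector/sector_disc].
apply: (@lower_integral_lt _ (plane R) R (leb2 R) (@unit_disc R) (@unit_disc R `\`
    sector) regular_part) => //.
- exact: measurable_disc.
- by apply: measurableD; [exact: measurable_disc|exact: measurable_sector].
- exact: measurable_regular_part.
- by apply/seteqP; split => // x [[_ nS] /regular_part_sector].
- rewrite -kinks_null; congr (leb2 R _); apply/seteqP; split => x.
    by move=> [Dx nx]; split; [apply: contrapT => nS; apply: nx; left|move=> cx;
        apply: nx; right].
  by move=> [Sx ncx]; split; [exact: sector_disc|move=> [[]|]].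
- by move=> x; rewrite lee_fin.
- by move=> x; rewrite lee_fin.
- move=> x [_ nS]; have dx : depth x < 0 by rewrite ltNge; apply/negP.
  have E : \forall y \near x, u y = lowered y.
    by apply: filterS (near_depthN dx) => y dy; rewrite lowered_out.
  by rewrite /sqr_grad !(near_eq_derive _ E).
- by apply/measurable_EFinP; exact: measurable_resist measurable_cone_height tu.
- by apply/measurable_EFinP; exact: measurable_resist measurable_lowered_height tl.
- apply: (@integral_lt_compensated _ (plane R) R (leb2 R) regular_part
    (fun x => (sqr_grad u x + 1)^-1) (fun x => (sqr_grad lowered x + 1)^-1) kd) => //.
  + exact: measurable_regular_part.
  + exact: leb2_regular_part_gt0.
  + apply: (le_lt_trans _ leb2_disc); apply: le_measure; rewrite ?inE.
    * exact: measurable_regular_part.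
    * exact: measurable_disc.
    * by move=> x /regular_part_sector/sector_disc.
  + exact: measurable_resist measurable_cone_height tu.
  + exact: measurable_resist measurable_lowered_height tl.
  + by move=> x _; rewrite inv_ge0 inv_le1.
  + by move=> x _; rewrite inv_ge0 inv_le1.
  + move=> x cx; have [phi phiab up] := regular_part_tangent cx.
    have [q [lq _ qE]] := lowered_tangent cx up.
    rewrite (sqr_grad_tangent up) (sqr_grad_tangent lq) /kd (tangent_derive d up)
        (tangent_derive d lq).
    suff : resist q + dot q d <= al0 by have := Hu _ phiab => ? ?; lra.
    case: qE => ->//; have := Hk _ phiab; congr (_ + _ <= _).
    by rewrite /dot/=; ring.
- apply: (@le_lt_trans _ _ (leb2 R (@unit_disc R))); last exact: leb2_disc.
  have E := integral_indic (leb2 R) measurableT measurable_disc.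
  rewrite setIT in E; rewrite -E.
  rewrite [leLHS]integral_mkcond; apply: ge0_le_lower_integral => x.
    by rewrite patchE; case: ifP => // _; rewrite lee_fin.
  by rewrite patchE indicE; case: ifP => // _; rewrite lee_fin.
Qed.
End contact.

(** * Choice of the sector and of the scaling factor *)

Lemma last_crossing (R : realType) (F : R -> R) (p q : R) : continuous F ->
  p < q -> F p <= 0 -> 0 < F q ->
  exists a, [/\ p <= a, a < q, F a <= 0 & forall x, a < x <= q -> 0 < F x].
Proof.
move=> cF pq Fp Fq.
pose S := [set x | [/\ p <= x, x <= q & F x <= 0]].
have Sp : S p by split => //; exact: ltW.
have Sub : has_ubound S by exists q => x [].
have S0 : S !=set0 by exists p.
have cS : closed S.
  have -> : S = (`[p, q]%classic : set R) `&` (F @^-1` [set y | y <= 0]).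
    apply/seteqP; split=> x; rewrite /S/= in_itv/=.
      by move=> [-> ->].
    by move=> [/andP[? ?] ?].
  apply: closedI; first exact: interval_closed.
  by apply: closed_comp => [x _|]; [exact: cF|exact: closed_le].
have [pa aq Fa] : S (sup S) by apply: cS; exact: closure_sup.
exists (sup S); split => //.
  rewrite lt_neqAle aq andbT; apply/eqP => h; move: Fq.
  by rewrite -h ltNge Fa.
move=> x /andP[ax xq]; rewrite ltNge; apply/negP => Fx.
have : x <= sup S.
  apply: ub_le_sup => //; split => //; exact: le_trans pa (ltW ax).
by rewrite leNgt ax.
Qed.

Lemma first_crossing (R : realType) (F : R -> R) (p q : R) : continuous F ->
  p < q -> F q <= 0 -> 0 < F p ->
  exists b, [/\ p < b, b <= q, F b <= 0 & forall x, p <= x < b -> 0 < F x].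
Proof.
move=> cF pq Fq Fp.
have cG : continuous (fun x => F (- x)).
  by move=> x; apply: (@continuous_comp _ _ _ -%R F); [exact: opp_continuous|exact: cF].
have [|||a [qa ap Fa H]] := @last_crossing R (fun x => F (- x)) (- q) (- p) cG.
- by rewrite ltrN2.
- by rewrite opprK.
- by rewrite opprK.
exists (- a); split => //; rewrite 1?ltrNr 1?lerNl//.
move=> x /andP[px xa]; rewrite -(opprK x); apply: H.
by rewrite ltrNr xa lerN2.
Qed.

Section tilt.
Context (R : realType).

(** Read with [g], [h] the slopes at two angles whose difference has cosine [1 - w]:
the terms of first order cancel because [- m] is the derivative of [1 / (1 + h^2)]. *)
Lemma tilt_identity (g h z w Y sig : R) (N := 1 + g ^+ 2) (P := 1 + h ^+ 2)
    (m := 2 * h / P ^+ 2) : (g - h) ^+ 2 = w * Y ->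
  N^-1 + (m * (g * (1 - w)) - sig * (z - g * w)) =
  P^-1 + (m * h - sig * z) +
  w * ((Y * (h ^+ 2 + 2 * g * h - 1) - 2 * h * g * N) / (N * P ^+ 2) + sig * g).
Proof.
move=> e.
have N0 : N != 0 by rewrite gt_eqF// ltr_pwDl// sqr_ge0.
have P0 : P != 0 by rewrite gt_eqF// ltr_pwDl// sqr_ge0.
transitivity (P^-1 + (m * h - sig * z) +
  (((g - h) ^+ 2 * (h ^+ 2 + 2 * g * h - 1) - w * (2 * h * g * N)) / (N * P ^+ 2) + w *
      (sig * g))); last first.
  by rewrite e; field; apply/andP; split.
rewrite /m /N /P; field; apply/andP; split; rewrite -?/N -?/P//.
Qed.

(** The first order expansion of the left-hand side at [k = 1], with an explicit
remainder, uniform for bounded [g]. *)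
Lemma scaled_bound (g k : R) : 0 < g -> 1 <= k <= 2 ->
  (1 + k ^+ 2 * g ^+ 2)^-1 - (1 + g ^+ 2)^-1 <=
  (k - 1) * (- (2 * g ^+ 2 / (1 + g ^+ 2) ^+ 2) + 5 * (k - 1) * g ^+ 4).
Proof.
move=> g0 /andP[k1 k2].
have N0 : 0 < 1 + g ^+ 2 by rewrite ltr_pwDl// sqr_ge0.
have K0 : 0 < 1 + k ^+ 2 * g ^+ 2 by rewrite ltr_pwDl// mulr_ge0// sqr_ge0.
have N1 : 1 <= 1 + g ^+ 2 by rewrite lerDl sqr_ge0.
have K1 : 1 <= 1 + k ^+ 2 * g ^+ 2 by rewrite lerDl mulr_ge0// sqr_ge0.
set N := 1 + g ^+ 2 in N0 N1 *; set K := 1 + _ * _ in K0 K1 *.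
rewrite -subr_ge0.
have -> : (k - 1) * (- (2 * g ^+ 2 / N ^+ 2) + 5 * (k - 1) * g ^+ 4) - (K^-1 - N^-1) =
  (k - 1) ^+ 2 * g ^+ 2 * (5 * g ^+ 2 + (1 - g ^+ 2 * (1 + 2 * k)) / (N ^+ 2 * K)).
  have K0' : 0 < 1 + (k * g) ^+ 2 by rewrite exprMn.
  by rewrite /N /K; field; rewrite -/N !gt_eqF.
apply: mulr_ge0; first by rewrite mulr_ge0// sqr_ge0.
have NK : 1 <= N ^+ 2 * K by rewrite mulr_ege1// exprn_ege1.
have : - (g ^+ 2 * (1 + 2 * k)) <= (1 - g ^+ 2 * (1 + 2 * k)) / (N ^+ 2 * K).
  rewrite ler_pdivlMr ?(lt_le_trans ltr01)//.
  have h : 0 <= g ^+ 2 * (1 + 2 * k) by rewrite mulr_ge0 ?sqr_ge0//; lra.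
  by nra.
have := sqr_ge0 g; nra.
Qed.
End tilt.

Section cone_tilt.
Context (R : realType) (V : R * R) (r : R).
Context (r0 : 0 <= r) (r1 : r < 1) (Vr : dot V V = r ^+ 2).
Context (z : R) (z0 : 0 < z).

Local Notation g := (slope V z).

Lemma continuous_dot_dir (w : R * R) : continuous (fun phi => dot w (dir phi)).
Proof.
move=> phi; apply: cvgD; apply: cvgM; try exact: cvg_cst.
  exact: continuous_cos.
exact: continuous_sin.
Qed.

Lemma continuous_slope : continuous g.
Proof.
move=> phi; apply: cvgM; first exact: cvg_cst.
apply: cvgV; first by rewrite gt_eqF// (dot_V_lt1 r0 r1 Vr).
by apply: cvgB; [exact: cvg_cst|exact: continuous_dot_dir].
Qed.

Lemma dot_dir_diff (phi f0 : R) :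
  (dot V (dir phi) - dot V (dir f0)) ^+ 2 =
  2 * (1 - cos (phi - f0)) * cross V (dir ((phi + f0) / 2)) ^+ 2.
Proof.
have [m [h [-> ->]]] : exists m h, phi = m + h /\ f0 = m - h.
  by exists ((phi + f0) / 2), ((phi - f0) / 2); split; field.
have -> : m + h - (m - h) = h *+ 2 by rewrite mulr2n; ring.
have -> : (m + h + (m - h)) / 2 = m by field.
rewrite cos_mulr2n (cos2sin2 h) mulr2n /dot /cross /dir/= !(cosB, sinB, cosD, sinD).
ring.
Qed.

Lemma resist_cone_grad phi : resist (cone_grad V z phi) = (1 + g phi ^+ 2)^-1.
Proof.
rewrite /resist /cone_grad/= !exprMn -mulrDr cos2Dsin2 mulr1 addrC//.
Qed.

Lemma resist_cone_gradZ (k phi : R) :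
  resist (k * (cone_grad V z phi).1, k * (cone_grad V z phi).2) =
      (1 + k ^+ 2 * g phi ^+ 2)^-1.
Proof.
by rewrite /resist /cone_grad/= !exprMn -!mulrDr cos2Dsin2 mulr1 addrC.
Qed.

Context (f0 : R).
Local Notation h := (g f0).
Local Notation P := (1 + h ^+ 2).
Local Notation m := (2 * h / P ^+ 2).

(** The sum of [- grad f] at the gradient along the ray [f0] and of a multiple of that
ray. *)
Definition tilt_dir (sig : R) : R * R :=
  (m * cos f0 - sig * (edge V f0).1, m * sin f0 - sig * (edge V f0).2).

Definition tilted (sig phi : R) : R :=
  resist (cone_grad V z phi) + dot (cone_grad V z phi) (tilt_dir sig).

Lemma dot_tilt_dir (sig phi : R) (w := 1 - cos (phi - f0)) :
  dot (cone_grad V z phi) (tilt_dir sig) = m * (g phi * (1 - w)) - sig *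
      (z - g phi * w).
Proof.
have -> : z - g phi * w = g phi * (1 - dot V (dir phi)) - g phi * w.
  by rewrite (slopeE r0 r1 Vr).
by rewrite /w subKr cosB /dot /tilt_dir /cone_grad/=; ring.
Qed.

(** The coefficient of [1 - cos (phi - f0)] in [tilted], see [tiltedE]. *)
Definition tilt_coef (sig phi : R) : R :=
  (2 * cross V (dir ((phi + f0) / 2)) ^+ 2 * z ^+ 2 /
     ((1 - dot V (dir phi)) * (1 - dot V (dir f0))) ^+ 2 * (h ^+ 2 + 2 * g phi * h - 1)
   - 2 * h * g phi * (1 + g phi ^+ 2)) / ((1 + g phi ^+ 2) * P ^+ 2) + sig * g phi.

Lemma tiltedE (sig phi : R) : tilted sig phi =
  P^-1 + (m * h - sig * z) + (1 - cos (phi - f0)) * tilt_coef sig phi.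
Proof.
rewrite /tilted resist_cone_grad dot_tilt_dir; apply: tilt_identity.
have c1 := dot_V_lt1 r0 r1 Vr phi; have c2 := dot_V_lt1 r0 r1 Vr f0.
transitivity (z ^+ 2 * (dot V (dir phi) - dot V (dir f0)) ^+ 2 / ((1 - dot V (dir phi))
    * (1 - dot V (dir f0))) ^+ 2).
  by rewrite /slope; field; rewrite !gt_eqF.
by rewrite dot_dir_diff; field; rewrite !gt_eqF.
Qed.

Lemma continuous_tilted sig : continuous (tilted sig).
Proof.
move=> phi; have cs := @continuous_slope.
have -> : tilted sig = (fun phi => (1 + g phi ^+ 2)^-1 + dot (cone_grad V z phi)
    (tilt_dir sig)).
  by apply/funext => y; rewrite /tilted resist_cone_grad.
apply: cvgD.
  apply: cvgV; first by rewrite gt_eqF// ltr_pwDl// sqr_ge0.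
  by apply: cvgD; [exact: cvg_cst|apply: cvgM; exact: cs].
by apply: cvgD; (apply: cvgM; last exact: cvg_cst); apply: cvgM; try exact: cs;
  [exact: continuous_cos|exact: continuous_sin].
Qed.

Lemma continuous_tilt_coef sig : continuous (tilt_coef sig).
Proof.
move=> phi; have cs := @continuous_slope.
have c1 := dot_V_lt1 r0 r1 Vr phi; have c2 := dot_V_lt1 r0 r1 Vr f0.
have cm : {for phi, continuous (fun phi => (phi + f0) / 2)}.
  by apply: cvgM; [apply: cvgD; [exact: cvg_id|exact: cvg_cst]|exact: cvg_cst].
have cX : {for phi, continuous (fun phi => cross V (dir ((phi + f0) / 2)))}.
  apply: cvgB; apply: cvgM; try exact: cvg_cst.
    by apply: (continuous_comp cm); exact: continuous_sin.
  by apply: (continuous_comp cm); exact: continuous_cos.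
have cY : {for phi, continuous (fun phi => ((1 - dot V (dir phi)) *
    (1 - dot V (dir f0))) ^+ 2)}.
  by apply: cvgM; apply: cvgM; try exact: cvg_cst; apply: cvgB; try exact: cvg_cst;
      exact: continuous_dot_dir.
have cN : {for phi, continuous (fun phi => 1 + g phi ^+ 2)}.
  by apply: cvgD; [exact: cvg_cst|apply: cvgM; exact: cs].
apply: cvgD; last by apply: cvgM; [exact: cvg_cst|exact: cs].
apply: cvgM; last first.
  apply: cvgV; last by apply: cvgM; [exact: cN|exact: cvg_cst].
  by rewrite mulf_neq0 ?expf_neq0// gt_eqF// ltr_pwDl// sqr_ge0.
apply: cvgB; last first.
  by apply: cvgM; [apply: cvgM; [exact: cvg_cst|exact: cs]|exact: cN].
apply: cvgM; last first.
  apply: cvgB; last exact: cvg_cst.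
  apply: cvgD; first exact: cvg_cst.
  apply: cvgM; last exact: cvg_cst.
  by apply: cvgM; [exact: cvg_cst|exact: cs].
apply: cvgM.
  apply: cvgM; last exact: cvg_cst.
  by apply: cvgM; [exact: cvg_cst|apply: cvgM; exact: cX].
by apply: cvgV; [rewrite expf_neq0// mulf_neq0// gt_eqF|exact: cY].
Qed.

Let c := 1 - dot V (dir f0).
Let X := cross V (dir f0).

(** Up to a positive factor, the coefficient at [f0] is the second derivative of the
integrand orthogonally to the ray, plus the contribution of [sig]. *)
Lemma tilt_coef_center (sig : R) : tilt_coef sig f0 =
  2 * h ^+ 2 / (c ^+ 4 * P ^+ 3) * (z ^+ 2 * (3 * X ^+ 2 - c ^+ 2) - c ^+ 2 *
      (c ^+ 2 + X ^+ 2)) + sig * h.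
Proof.
have c0 : 0 < c := dot_V_lt1 r0 r1 Vr f0.
rewrite /tilt_coef (_ : (f0 + f0) / 2 = f0); last by field.
congr (_ + _); rewrite -/X -/c (_ : h = z / c)//.
have P0 : 0 < 1 + (z / c) ^+ 2 by rewrite ltr_pwDl// sqr_ge0.
have Q0 : 0 < c ^+ 2 + z ^+ 2 by rewrite ltr_pwDl ?exprn_gt0// sqr_ge0.
by field; rewrite !gt_eqF.
Qed.

(** [sig] is taken so small that the maximum of [tilted] at [f0] persists.  At the
scaled gradients the values drop by about [(kap - 1) * sig * z], because the radial
derivative of the tilted integrand at [f0] is [- sig * z].  A level between these
values and the maximum cuts out the arc [[a, b]]. *)
Lemma tilt_exists (al be : R) : al < f0 -> f0 < be ->
  z ^+ 2 * (3 * X ^+ 2 - c ^+ 2) < c ^+ 2 * (c ^+ 2 + X ^+ 2) ->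
  exists A B a b kap (d : R * R) (al0 : R), [/\
    [/\ al <= A, B <= be, B - A < pi & r < cos (B - A)],
    [/\ A < a, a < b & b < B], 1 < kap &
    [/\ forall phi, a < phi < b -> al0 < resist (cone_grad V z phi) + dot
        (cone_grad V z phi) d,
      resist (cone_grad V z a) + dot (cone_grad V z a) d <= al0,
      resist (cone_grad V z b) + dot (cone_grad V z b) d <= al0 &
      forall phi, a < phi < b ->
        resist (kap * (cone_grad V z phi).1, kap * (cone_grad V z phi).2) +
        kap * dot (cone_grad V z phi) d <= al0]].
Proof.
move=> alf fbe cond.
have c0 : 0 < c := dot_V_lt1 r0 r1 Vr f0.
have h0 : 0 < h := slope_gt0 r0 r1 Vr z0 f0.
have P0 : 0 < P by rewrite ltr_pwDl// sqr_ge0.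
(* the arc on which edges turn, with [r < cos (B - A)] *)
have [e0 [e00 e0al e0be e0pi e0r]] : exists e, [/\ 0 < e, al <= f0 - e, f0 + e <= be,
    f0 + e - (f0 - e) < pi & r < cos (f0 + e - (f0 - e))].
  have cc : {for (0 : R), continuous (fun x : R => cos (x *+ 2))}.
    apply: (@continuous_comp _ _ _ (fun x : R => x *+ 2) (@cos R));
        last exact: continuous_cos.
    by apply: cvgMn; exact: cvg_id.
  have r1' : r < cos (0 *+ 2) by rewrite mul0rn cos0.
  have H1 : \forall x \near (0 : R), r < cos (x *+ 2) := cc _ (lt_nbhsr r1').
  have /nbhs_ballP[e1 /= e10 he1] := H1.
  pose e := Num.min (Num.min (e1 / 2) 2^-1) (Num.min (f0 - al) (be - f0)).
  have e0 : 0 < e by rewrite !lt_min divr_gt0// invr_gt0 ltr0n !subr_gt0 alf.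
  have E : f0 + e - (f0 - e) = e *+ 2 by rewrite mulr2n; ring.
  exists e; rewrite E; split => //.
  - by rewrite lerBrDl -lerBrDr !ge_min lexx orbT.
  - by rewrite -lerBrDl !ge_min lexx !orbT.
  - have : e <= 2^-1 by rewrite !ge_min lexx !orbT.
    rewrite mulr2n => eh; apply: lt_le_trans (pi_ge2 R).
    by apply: le_lt_trans (lerD eh eh) _; rewrite -[2^-1]mul1r -splitr ltr1n.
  - apply: he1; rewrite /ball/= sub0r normrN gtr0_norm//.
    have : e <= e1 / 2 by rewrite !ge_min lexx.
    by move=> ?; lra.
(* the tilt, small enough for the coefficient at f0 to remain negative *)
pose Q := c ^+ 2 * (c ^+ 2 + X ^+ 2) - z ^+ 2 * (3 * X ^+ 2 - c ^+ 2).
have Q0 : 0 < Q by rewrite subr_gt0.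
pose sig := h / (c ^+ 4 * P ^+ 3) * Q.
have D0 : 0 < c ^+ 4 * P ^+ 3 by rewrite mulr_gt0// exprn_gt0.
have sig0 : 0 < sig by rewrite mulr_gt0// divr_gt0.
have k0 : tilt_coef sig f0 < 0.
  rewrite tilt_coef_center (_ : _ + _ = - (sig * h)); last first.
    by rewrite /sig /Q; ring.
  by rewrite oppr_lt0 mulr_gt0.
pose B1 phi := dot (cone_grad V z phi) (tilt_dir sig) - 2 * g phi ^+ 2 /
    (1 + g phi ^+ 2) ^+ 2.
have cB1 : continuous B1.
  move=> phi; have cs := @continuous_slope.
  apply: cvgB.
    by apply: cvgD; (apply: cvgM; last exact: cvg_cst); apply: cvgM; try exact: cs;
      [exact: continuous_cos|exact: continuous_sin].
  have cN : {for phi, continuous (fun phi => 1 + g phi ^+ 2)}.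
    by apply: cvgD; [exact: cvg_cst|apply: cvgM; exact: cs].
  apply: cvgM; first by apply: cvgM; [exact: cvg_cst|apply: cvgM; exact: cs].
  apply: cvgV; last by apply: cvgM; exact: cN.
  by rewrite expf_neq0// gt_eqF// ltr_pwDl// sqr_ge0.
have B10 : B1 f0 < - (sig * z / 2).
  rewrite /B1 dot_tilt_dir subrr cos0 subrr subr0 mulr0 subr0 mulr1.
  have -> : m * h - sig * z - 2 * h ^+ 2 / P ^+ 2 = - (sig * z).
    by field; rewrite gt_eqF.
  by have := mulr_gt0 sig0 z0; lra.
have near1 : \forall x \near f0, tilt_coef sig x < 0 := continuous_tilt_coef
    (lt_nbhsl k0).
have near2 : \forall x \near f0, B1 x < - (sig * z / 2) := cB1 _ _ (lt_nbhsl B10).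
have [e1 e10 He1] : exists2 e, 0 < e & forall x, f0 - e <= x <= f0 + e ->
    tilt_coef sig x < 0 /\ B1 x < - (sig * z / 2).
  have near12 : \forall x \near f0, tilt_coef sig x < 0 /\ B1 x < - (sig * z / 2).
    exact: filterI near1 near2.
  have /nbhs_ballP[e /= ep He] := near12.
  exists (e / 2); first by rewrite divr_gt0.
  move=> x /andP[x1 x2]; apply: He; rewrite /ball/= ltr_norml.
  by apply/andP; split; lra.
pose de := Num.min e1 (e0 / 2).
have de0 : 0 < de by rewrite lt_min e10 divr_gt0.
have dee1 : de <= e1 by rewrite ge_min lexx.
have dee0 : de < e0.
  by have : de <= e0 / 2 by [rewrite ge_min lexx orbT]; lra.
have depi : de < pi by lra.
pose psi0 := P^-1 + (m * h - sig * z).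
have tl x : f0 - de <= x <= f0 + de -> tilted sig x <= psi0.
  move=> /andP[x1 x2]; rewrite tiltedE gerDl mulr_ge0_le0 ?subr_ge0 ?cos_le1//.
  have [|/ltW //] := He1 x.
  by apply/andP; split; lra.
have cosde : 0 < 1 - cos de.
  rewrite subr_gt0 -(@cos0 R) ltr_cos ?in_itv/= ?lexx ?pi_ge0//.
  by rewrite (ltW de0) ltW.
have tlr : tilted sig (f0 + de) < psi0.
  rewrite tiltedE gtrDl (_ : f0 + de - f0 = de); last by ring.
  rewrite pmulr_rlt0//.
  by have [] := He1 (f0 + de); first by apply/andP; split; lra.
have tll : tilted sig (f0 - de) < psi0.
  rewrite tiltedE gtrDl (_ : f0 - de - f0 = - de); last by ring.
  rewrite cosN pmulr_rlt0//.
  by have [] := He1 (f0 - de); first by apply/andP; split; lra.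
(* [mu = kap - 1]: small against the remainder in [scaled_bound], and so that the
   level is not reached before the ends of the interval *)
pose L := max_slope r z.
have L0 : 0 < L := max_slope_gt0 r0 r1 Vr z0.
have sz : 0 < sig * z by rewrite mulr_gt0.
pose mu := Num.min (Num.min 1 (sig * z / (20 * L ^+ 4)))
  (Num.min ((psi0 - tilted sig (f0 + de)) * 4 / (sig * z))
     ((psi0 - tilted sig (f0 - de)) * 4 / (sig * z))).
have L4 : 0 < 20 * L ^+ 4 by rewrite mulr_gt0// exprn_gt0.
have mu0 : 0 < mu.
  by rewrite !lt_min ltr01 (divr_gt0 sz L4) !(divr_gt0 _ sz)// mulr_gt0// subr_gt0.
have mu1 : mu <= 1 by rewrite !ge_min lexx.
have muL : 5 * mu * L ^+ 4 <= sig * z / 4.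
  have : mu <= sig * z / (20 * L ^+ 4) by rewrite !ge_min lexx !orbT.
  by rewrite (ler_pdivlMr _ _ L4) => ?; lra.
have mur : tilted sig (f0 + de) <= psi0 - mu * (sig * z / 4).
  have : mu <= (psi0 - tilted sig (f0 + de)) * 4 / (sig * z) by rewrite !ge_min lexx
      !orbT.
  by rewrite (ler_pdivlMr _ _ sz) => ?; lra.
have mul : tilted sig (f0 - de) <= psi0 - mu * (sig * z / 4).
  have : mu <= (psi0 - tilted sig (f0 - de)) * 4 / (sig * z) by rewrite !ge_min lexx
      !orbT.
  by rewrite (ler_pdivlMr _ _ sz) => ?; lra.
pose al0 := psi0 - mu * (sig * z / 4).
have F0 : 0 < tilted sig f0 - al0.
  rewrite tiltedE subrr cos0 subrr mul0r addr0 -/psi0 /al0 opprB addrCA subrr addr0.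
  by rewrite mulr_gt0// divr_gt0.
have cF : continuous (fun x => tilted sig x - al0).
  by move=> x; apply: cvgB; [exact: continuous_tilted|exact: cvg_cst].
have [|||a [da af Fa Ha]] := last_crossing (p := f0 - de) (q := f0) cF.
- by rewrite gtrBl.
- by rewrite subr_le0.
- by [].
have [|||b [fb bd Fb Hb]] := first_crossing (p := f0) (q := f0 + de) cF.
- by rewrite ltrDl.
- by rewrite subr_le0.
- by [].
exists (f0 - e0), (f0 + e0), a, b, (1 + mu), (tilt_dir sig), al0; split.
- by [].
- split; [|exact: lt_trans fb|].
    by rewrite (lt_le_trans _ da)// ltrD2l ltrN2.
  by rewrite (le_lt_trans bd)// ltrD2l.
- by rewrite ltrDl.
split.
- move=> phi /andP[aphi phib]; rewrite -subr_gt0.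
  have [pf|fp] := leP phi f0; first by apply: Ha; rewrite aphi.
  by apply: Hb; rewrite (ltW fp).
- by rewrite -subr_le0.
- by rewrite -subr_le0.
move=> phi /andP[aphi phib].
have phide : f0 - de <= phi <= f0 + de by apply/andP; split; lra.
have [_ Bphi] : tilt_coef sig phi < 0 /\ B1 phi < - (sig * z / 2).
  by apply: He1; case/andP: phide => ? ?; apply/andP; split; lra.
have gp : 0 < g phi := slope_gt0 r0 r1 Vr z0 phi.
have gL : g phi <= L := slope_le r0 r1 Vr z0 phi.
have k12 : 1 <= 1 + mu <= 2 by apply/andP; split; lra.
have sb := scaled_bound gp k12.
rewrite -resist_cone_gradZ -resist_cone_grad (_ : 1 + mu - 1 = mu) in sb; last by ring.
have g4 : g phi ^+ 4 <= L ^+ 4 by rewrite lerXn2r ?nnegrE// ltW.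
have g5 : 5 * mu * g phi ^+ 4 <= sig * z / 4.
  by rewrite (le_trans _ muL)// ler_wpM2l// mulr_ge0// ltW.
have tphi := tl _ phide; rewrite /tilted in tphi; rewrite /B1 in Bphi; rewrite /al0.
move: (dot (cone_grad V z phi) _) (resist (cone_grad V z phi)) (resist _) sb g5 tphi
    Bphi => dd rs rk.
move: (2 * _ / _) (5 * mu * _) => T G sb g5 tphi Bphi.
have : mu * (dd - T + G) <= mu * - (sig * z / 4) by rewrite ler_wpM2l ?(ltW mu0)//; lra.
by move=> ?; lra.
Qed.

End cone_tilt.

(** * The theorem *)

(** Move [phi] slightly towards the midpoint. *)
Lemma near_interior (R : realType) (Q : R -> R) (al be phi : R) : continuous Q ->
  al < be -> al <= phi <= be -> Q phi < 0 ->
  exists f0, [/\ al < f0, f0 < be & Q f0 < 0].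
Proof.
move=> cQ albe /andP[alphi phibe] Qphi.
have c : {for (0 : R), continuous (fun t : R => Q (phi + t * ((al + be) / 2 - phi)))}.
  apply: (@continuous_comp _ _ _ (fun t : R => phi + t * ((al + be) / 2 - phi)) Q);
      last exact: cQ.
  by apply: cvgD; [exact: cvg_cst|apply: cvgM; [exact: cvg_id|exact: cvg_cst]].
have Q0 : Q (phi + 0 * ((al + be) / 2 - phi)) < 0 by rewrite mul0r addr0.
have H : \forall t \near (0 : R), Q (phi + t * ((al + be) / 2 - phi)) < 0 :=
    c _ (lt_nbhsl Q0).
have /nbhs_ballP[e /= e0 he] := H.
pose t := Num.min (e / 2) 2^-1.
have t0 : 0 < t by rewrite lt_min divr_gt0// invr_gt0 ltr0n.
have te : t <= e / 2 by rewrite ge_min lexx.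
have t2 : t <= 2^-1 by rewrite ge_min lexx orbT.
exists (phi + t * ((al + be) / 2 - phi)); split; last first.
- by apply: he; rewrite /ball/= sub0r normrN gtr0_norm//; lra.
- have -> : phi + t * ((al + be) / 2 - phi) = (1 - t) * phi + t * ((al + be) / 2)
    by ring.
  have h1 : (1 - t) * phi <= (1 - t) * be by rewrite ler_wpM2l//; lra.
  have h2 : t * ((al + be) / 2) < t * be by rewrite ltr_pM2l//; lra.
  by lra.
- have -> : phi + t * ((al + be) / 2 - phi) = (1 - t) * phi + t * ((al + be) / 2)
    by ring.
  have h1 : (1 - t) * al <= (1 - t) * phi by rewrite ler_wpM2l//; lra.
  have h2 : t * al < t * ((al + be) / 2) by rewrite ltr_pM2l//; lra.
  by lra.
Qed.

Unset Implicit Arguments.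

Theorem corollary7 (R : realType) (M : R) (hM : 0 < M)
    (u : R * R -> R) (hu : newton_class M u)
    (x0 y0 z0 r0 phi0 alpha beta : R)
    (hz0 : 0 < z0) (hr0 : 0 < r0 < 1)
    (hx0 : x0 = r0 * cos phi0) (hy0 : y0 = r0 * sin phi0)
    (hab : alpha < beta)
    (hcone : conical_part u x0 y0 z0 alpha beta)
    (hphi : exists phi : R, alpha <= phi <= beta /\
      (3 * r0 ^+ 2 * sin (phi - phi0) ^+ 2
         - (1 - r0 * cos (phi - phi0)) ^+ 2)
      / ((1 - r0 * cos (phi - phi0)) ^+ 2
         * (1 + r0 ^+ 2 - 2 * r0 * cos (phi - phi0)))
      < z0 ^- 2) :
  ~ newton_minimizer M u.
Proof.
pose V : R * R := (x0, y0).
have [r00 r01] := andP hr0; have r0' := ltW r00.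
have Vr : dot V V = r0 ^+ 2.
  rewrite /dot/= hx0 hy0.
  have -> : r0 ^+ 2 = r0 ^+ 2 * (cos phi0 ^+ 2 + sin phi0 ^+ 2) by rewrite cos2Dsin2
      mulr1.
  ring.
have DV phi : dot V (dir phi) = r0 * cos (phi - phi0).
  by rewrite /dot/= hx0 hy0 cosB; ring.
have XV phi : cross V (dir phi) = r0 * sin (phi - phi0).
  by rewrite /cross/= hx0 hy0 sinB; ring.
pose Q phi := z0 ^+ 2 * (3 * cross V (dir phi) ^+ 2 - (1 - dot V (dir phi)) ^+ 2)
  - (1 - dot V (dir phi)) ^+ 2 * ((1 - dot V (dir phi)) ^+ 2 + cross V (dir phi) ^+ 2).
have cX : continuous (fun phi => cross V (dir phi)).
  move=> phi; apply: cvgB; apply: cvgM; try exact: cvg_cst;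
      [exact: continuous_sin|exact: continuous_cos].
have cD : continuous (fun phi => 1 - dot V (dir phi)).
  by move=> phi; apply: cvgB; [exact: cvg_cst|exact: continuous_dot_dir].
have cQ : continuous Q.
  move=> phi; have cX2 : {for phi, continuous (fun phi => cross V (dir phi) ^+ 2)}.
    by apply: cvgM; exact: cX.
  have cD2 : {for phi, continuous (fun phi => (1 - dot V (dir phi)) ^+ 2)}.
    by apply: cvgM; exact: cD.
  apply: cvgB; apply: cvgM; try exact: cvg_cst => //.
  - by apply: cvgB; [apply: cvgM; [exact: cvg_cst|exact: cX2]|exact: cD2].
  - exact: cD2.
  - by apply: cvgD; [exact: cD2|exact: cX2].
have [phi [phiab Hphi]] := hphi.
have Qphi : Q phi < 0.
  have c0 := dot_V_lt1 r0' r01 Vr phi.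
  have E0 := edge_sqr_gt0 r0' r01 Vr phi; rewrite (edge_sqr Vr) in E0.
  have EE : 1 + r0 ^+ 2 - 2 * dot V (dir phi) = (1 - dot V (dir phi)) ^+ 2 + cross V
      (dir phi) ^+ 2.
    rewrite DV XV exprMn sin2cos2; ring.
  move: Hphi; rewrite -mulrA -(mulrA 2) -DV -exprMn -XV => Hphi.
  rewrite EE in E0 Hphi.
  move: Hphi; rewrite ltr_pdivrMr; last by rewrite mulr_gt0// exprn_gt0.
  by rewrite ltr_pdivlMl ?exprn_gt0// /Q subr_lt0.
have [f0 [alf fbe Qf0]] := near_interior cQ hab phiab Qphi.
rewrite /Q subr_lt0 in Qf0.
have [A [B [a [b [kap [d [al0 [[alA Bbe ABpi ABr] [Aa ab bB] kap1 [Hu Ha Hb Hk]]]]]]]]]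
    :=
  tilt_exists r0' r01 Vr hz0 alf fbe Qf0.
have [uM ucx ulsc] := hu.
have ucvx := (convex_function_lerp _ _).1 ucx.
have ucone t psi : 0 <= t <= 1 -> A <= psi <= B -> u (ray V t psi) = - ((1 - t) * z0).
  move=> t01 /andP[Apsi psiB]; apply: hcone => //.
  by rewrite (le_trans alA Apsi) (le_trans psiB Bbe).
move=> [_ umin].
have AB : A < B := lt_trans (lt_trans Aa ab) bB.
have vC : newton_class M (lowered V z0 u a b kap).
  split.
  - exact: (lowered_range r0' r01 Vr hz0 AB ABpi ABr ucvx ucone Aa ab bB uM kap1).
  - apply/convex_function_lerp.
    exact: (lowered_convex r0' r01 Vr hz0 AB ABpi ABr ucvx ucone Aa ab bB uM kap1).
  - exact: (lowered_lsc r0' r01 Vr hz0 AB ABpi ABr ucvx ucone Aa ab bB kap1 ulsc).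
have := lowered_resistance r0' r01 Vr hz0 AB ABpi ABr ucvx ucone Aa ab bB uM kap1 Hu Ha
    Hb Hk.
by rewrite ltNge umin.
Qed.
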